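(* Let $K$ be a field and let $A$ be a semiprimary $K$-algebra which is left self-injective. Assume that every simple left $A$-module has at most countable dimension over $K$ (equivalently, that $\dim_K(A/J)\leq\aleph_0$, where $J$ is the Jacobson radical of $A$). Then $A$ is a quasi-Frobenius (QF) ring.
   Context: Rings and algebras are associative with unit. A ring $A$ with Jacobson radical $J$ is semiprimary if $A/J$ is semisimple and $J$ is nilpotent. $A$ is left self-injective if the left $A$-module ${}_AA$ is injective. $A$ is quasi-Frobenius (QF) if it is left self-injective and left artinian; equivalently, $A$ is noetherian or artinian on one side and self-injective on one side. *)

(* Defs.v *)
From HB Require Import structures.
From mathcomp Require Import all_boot all_algebra.
From mathcomp Require Import boolp classical_sets functions cardinality.

Set Implicit Arguments.
Unset Strict Implicit.
Unset Printing Implicit Defensive.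

Import GRing.Theory.
Local Open Scope classical_set_scope.
Local Open Scope quotient_scope.
Local Open Scope ring_scope.

Definition submodule (R : pzRingType) (M : lmodType R) (N : set M) : Prop :=
  submod_closed [in N].

Definition left_ideal (R : pzRingType) (I : set R) : Prop :=
  @submodule R R^o I.

Definition simple_module (R : pzRingType) (M : lmodType R) : Prop :=
  (exists x : M, x <> 0) /\
  (forall N : set M, submodule N -> N = [set 0] \/ N = setT).

Definition semisimple_module (R : pzRingType) (M : lmodType R) : Prop :=
  forall N : set M, submodule N ->
    exists N' : set M,
      [/\ submodule N', N `&` N' = [set 0] &
          forall x, exists y z, [/\ N y, N' z & x = y + z]].

Definition semisimple_ring (R : pzRingType) : Prop :=
  @semisimple_module R R^o.

Definition injective_module (R : pzRingType) (E : lmodType R) : Prop :=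
  forall (M N : lmodType R) (i : {linear M -> N}) (f : {linear M -> E}),
    injective i -> exists g : {linear N -> E}, forall x, g (i x) = f x.

Definition left_self_injective (R : pzRingType) : Prop :=
  @injective_module R R^o.

Definition left_artinian (R : pzRingType) : Prop :=
  forall I : nat -> set R,
    (forall n, left_ideal (I n)) -> (forall n, I n.+1 `<=` I n) ->
    exists m, forall n, (m <= n)%N -> I n = I m.

Definition quasi_frobenius (R : pzRingType) : Prop :=
  left_self_injective R /\ left_artinian R.

Definition maximal_left_ideal (R : pzRingType) (m : set R) : Prop :=
  [/\ left_ideal m, m <> setT &
      forall I : set R, left_ideal I -> m `<=` I -> I = m \/ I = setT].

Definition jacobson (R : pzRingType) : set R :=
  [set x | forall m : set R, maximal_left_ideal m -> m x].

Section LeftIdealTheory.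
Variables (R : pzRingType) (I : set R).
Implicit Types a x y : R.

Lemma left_idealP :
  left_ideal I <-> I 0 /\ (forall a x y, I x -> I y -> I (a * x + y)).
Proof.
split=> [[I0 Il]|[I0 Il]].
  split; first by move: I0; rewrite !inE.
  by move=> a x y Ix Iy; have := Il a x y; rewrite !inE; apply.
split; first by rewrite !inE.
by move=> a x y; rewrite !inE; apply: Il.
Qed.

Hypothesis idI : left_ideal I.

Lemma left_ideal0 : I 0. Proof. by have [] := left_idealP.1 idI. Qed.

Lemma left_idealD x y : I x -> I y -> I (x + y).
Proof. by move=> Ix Iy; rewrite -[x]mul1r; apply: (left_idealP.1 idI).2. Qed.

Lemma left_idealM a x : I x -> I (a * x).
Proof.
move=> Ix; rewrite -[a * x]addr0; apply: (left_idealP.1 idI).2 => //.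
exact: left_ideal0.
Qed.

Lemma left_idealB x y : I x -> I y -> I (x - y).
Proof.
by move=> Ix Iy; apply: left_idealD => //; rewrite -mulN1r; apply: left_idealM.
Qed.
End LeftIdealTheory.

Section JacobsonTwoSided.
Variable R : pzRingType.
Implicit Types a r x y : R.
Local Notation J := (@jacobson R).

Lemma jacobson_left_ideal : left_ideal J.
Proof.
apply/left_idealP; split=> [m [mI _ _]|a x y Jx Jy m mm].
  exact: left_ideal0.
have [mI _ _] := mm; apply: left_idealD => //; last exact: Jy.
by apply: left_idealM => //; apply: Jx.
Qed.

(* If m is a maximal left ideal and r is not in m, then (m : r) is maximal. *)
Lemma maximal_left_ideal_colon (m : set R) r :
  maximal_left_ideal m -> ~ m r ->
  maximal_left_ideal [set a | m (a * r)].
Proof.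
move=> [mI m1 mmax] mr.
have cI : left_ideal [set a | m (a * r)].
  apply/left_idealP; split=> [|a x y /= mx my] /=.
    by rewrite mul0r; apply: left_ideal0.
  rewrite mulrDl -mulrA; apply: left_idealD => //; exact: left_idealM.
split=> // [/seteqP[_ /(_ 1 I)] /=|L LI mL]; first by rewrite mul1r.
case: (pselect (exists2 a, L a & ~ m (a * r))) => [[a La mar]|nL]; last first.
  left; apply/seteqP; split=> // a La /=.
  by apply: contrapT => mar; apply: nL; exists a.
right; apply/seteqP; split=> // c _.
pose P : set R := [set z | exists b y, m y /\ z = b * (a * r) + y].
have PI : left_ideal P.
  apply/left_idealP; split=> [|d x y [b [u [mu ->]]] [b' [u' [mu' ->]]]].
    by exists 0, 0; split; [exact: left_ideal0|rewrite mul0r addr0].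
  exists (d * b + b'), (d * u + u'); split.
    by apply: left_idealD => //; apply: left_idealM.
  by rewrite mulrDr mulrDl !mulrA -!addrA; congr (_ + _); rewrite addrCA.
have mP : m `<=` P by move=> y my; exists 0, y; rewrite mul0r add0r.
have Par : P (a * r).
  by exists 1, 0; split; [exact: left_ideal0|rewrite mul1r addr0].
case: (mmax P PI mP) => [Pm|PT]; first by case: mar; rewrite -Pm.
have [b [y [my cE]]] : P (c * r) by rewrite PT.
rewrite -[c](subrK (b * a)); apply: left_idealD => //.
  by apply: mL; rewrite /= mulrBl -(mulrA b) cE [_ + y]addrC addrK.
exact: left_idealM.
Qed.

Lemma jacobson_right x r : J x -> J (x * r).
Proof.
move=> Jx m mm; have [mI _ _] := mm.
case: (pselect (m r)) => [mr|mr]; first exact: left_idealM.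
exact: (Jx _ (maximal_left_ideal_colon mm mr)).
Qed.

Definition jacobson_pred : {pred R} := [in J].

Lemma jacobson_zmod_closed : zmod_closed jacobson_pred.
Proof.
split=> [|x y]; rewrite !inE.
  exact: (left_ideal0 jacobson_left_ideal).
exact: (left_idealB jacobson_left_ideal).
Qed.

HB.instance Definition _ :=
  GRing.isZmodClosed.Build R jacobson_pred jacobson_zmod_closed.

Definition jacobson_quotient : Type := Quotient.quot jacobson_pred.
Local Notation Q := jacobson_quotient.

HB.instance Definition _ := GRing.Zmodule.on Q.

Definition jacobson_proj (x : R) : Q := \pi_Q%qT x.

Lemma jacobson_projP x y : jacobson_proj x = jacobson_proj y <-> J (x - y).
Proof.
have -> : J (x - y) = (jacobson_pred (x - y)) :> Prop.
  by rewrite /jacobson_pred propeqE; split; rewrite -/(_ \in _) inE.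
rewrite [jacobson_pred _]Quotient.idealrBE.
by split=> [e|/eqP//]; apply/eqP.
Qed.

Lemma jacobson_proj_surj (q : Q) : exists x, q = jacobson_proj x.
Proof. by exists (repr q); rewrite /jacobson_proj reprK. Qed.

Definition jacobson_quotient_one : Q := jacobson_proj 1.
Definition jacobson_quotient_mul (p q : Q) : Q :=
  jacobson_proj (repr p * repr q).

Lemma jacobson_projB x y :
  jacobson_proj (x - y) = jacobson_proj x - jacobson_proj y.
Proof. by rewrite /jacobson_proj raddfB. Qed.

Lemma jacobson_projD x y :
  jacobson_proj (x + y) = jacobson_proj x + jacobson_proj y.
Proof. by rewrite /jacobson_proj raddfD. Qed.

Lemma jacobson_projM x y :
  jacobson_proj (x * y) =
  jacobson_quotient_mul (jacobson_proj x) (jacobson_proj y).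
Proof.
have Jrepr z : J (z - repr (jacobson_proj z)).
  by apply/jacobson_projP; rewrite {2}/jacobson_proj reprK.
apply/jacobson_projP; set x' := repr _; set y' := repr _.
have -> : x * y - x' * y' = x * (y - y') + (x - x') * y'.
  by rewrite mulrBr mulrBl addrA subrK.
apply: (left_idealD jacobson_left_ideal).
  by apply: (left_idealM jacobson_left_ideal); apply: Jrepr.
by apply: jacobson_right; apply: Jrepr.
Qed.

Let mulqA : associative jacobson_quotient_mul.
Proof.
move=> p q r; have [x ->] := jacobson_proj_surj p.
have [y ->] := jacobson_proj_surj q; have [z ->] := jacobson_proj_surj r.
by rewrite -!jacobson_projM mulrA.
Qed.

Let mul1q : left_id jacobson_quotient_one jacobson_quotient_mul.
Proof.
by move=> p; have [x ->] := jacobson_proj_surj p; rewrite -jacobson_projM mul1r.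
Qed.

Let mulq1 : right_id jacobson_quotient_one jacobson_quotient_mul.
Proof.
by move=> p; have [x ->] := jacobson_proj_surj p; rewrite -jacobson_projM mulr1.
Qed.

Let mulqDl : left_distributive jacobson_quotient_mul +%R.
Proof.
move=> p q r; have [x ->] := jacobson_proj_surj p.
have [y ->] := jacobson_proj_surj q; have [z ->] := jacobson_proj_surj r.
by rewrite -jacobson_projD -!jacobson_projM mulrDl jacobson_projD.
Qed.

Let mulqDr : right_distributive jacobson_quotient_mul +%R.
Proof.
move=> p q r; have [x ->] := jacobson_proj_surj p.
have [y ->] := jacobson_proj_surj q; have [z ->] := jacobson_proj_surj r.
by rewrite -jacobson_projD -!jacobson_projM mulrDr jacobson_projD.
Qed.

HB.instance Definition _ :=
  GRing.Zmodule_isPzRing.Build Q mulqA mul1q mulq1 mulqDl mulqDr.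

HB.instance Definition _ :=
  GRing.isZmodMorphism.Build R Q jacobson_proj jacobson_projB.

Let jacobson_proj_monoid : monoid_morphism jacobson_proj.
Proof. by split=> // x y; rewrite jacobson_projM. Qed.

HB.instance Definition _ :=
  GRing.isMonoidMorphism.Build R Q jacobson_proj jacobson_proj_monoid.

End JacobsonTwoSided.

(* J ^ n is additively generated by the n-fold products of elements of J, so
   J ^ n = 0 means that all these products vanish. *)
Definition jacobson_nilpotent (R : pzRingType) : Prop :=
  exists n, forall x : 'I_n -> R,
    (forall i, jacobson (x i)) -> \prod_(i < n) x i = 0.

Definition semiprimary (R : pzRingType) : Prop :=
  semisimple_ring (jacobson_quotient R) /\ jacobson_nilpotent R.

Definition restrict_scalars (K R : pzRingType) (f : {rmorphism K -> R})
  (M : lmodType R) : Type := M.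

Section RestrictScalars.
Variables (K R : pzRingType) (f : {rmorphism K -> R}) (M : lmodType R).
Local Notation fM := (restrict_scalars f M).

HB.instance Definition _ := GRing.Zmodule.on fM.

Definition restrict_scale (k : K) (v : fM) : fM := f k *: (v : M).

Let restrict_scaleA a b v :
  restrict_scale a (restrict_scale b v) = restrict_scale (a * b) v.
Proof. by rewrite /restrict_scale scalerA rmorphM. Qed.

Let restrict_scale1 : left_id 1 restrict_scale.
Proof. by move=> v; rewrite /restrict_scale rmorph1 scale1r. Qed.

Let restrict_scaleDr : right_distributive restrict_scale +%R.
Proof. by move=> a u v; exact: scalerDr. Qed.

Let restrict_scaleDl v : {morph restrict_scale^~ v : a b / a + b}.
Proof. by move=> a b; rewrite /restrict_scale rmorphD scalerDl. Qed.

HB.instance Definition _ := GRing.Zmodule_isLmodule.Build K fM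
  restrict_scaleA restrict_scale1 restrict_scaleDr restrict_scaleDl.

End RestrictScalars.

Section Dimension.
Variables (K : fieldType) (V : lmodType K).

Definition lin_independent (B : set V) : Prop :=
  forall n (e : 'I_n -> V) (c : 'I_n -> K),
    injective e -> (forall i, B (e i)) ->
    \sum_(i < n) c i *: e i = 0 -> forall i, c i = 0.

Definition spanning (B : set V) : Prop :=
  forall v, exists n (e : 'I_n -> V) (c : 'I_n -> K),
    (forall i, B (e i)) /\ v = \sum_(i < n) c i *: e i.

Definition countable_dim : Prop :=
  exists B : set V, [/\ lin_independent B, spanning B & countable B].

End Dimension.

(* Main.v *)
Require Import Defs.
From HB Require Import structures.
From mathcomp Require Import all_boot all_algebra.
From mathcomp Require Import boolp classical_sets functions cardinality.

Set Implicit Arguments.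
Unset Strict Implicit.
Unset Printing Implicit Defensive.

Import GRing.Theory.
Local Open Scope classical_set_scope.
Local Open Scope ring_scope.

(** Let [J] be the radical of [A]. If [J / J^2] is a finitely generated left
    module then, [J] being nilpotent and [A / J] semisimple, [A] has a finite
    composition series and is left artinian ([left_artinian_of_generators]).
    Otherwise [J / J^2] is a direct sum of simple modules [A x], with [x] in an
    infinite set [I], and a contradiction comes from comparing two sizes.

    The ring is small. If the countable set [C] spans [A / J] over [K], then,
    [J] being nilpotent, the products of elements of [C] and [I] span [A] over
    [K] ([word_span_all]), and there are no more of them than elements of [I]
    ([inj_seq_infinite]).

    The ring is big. A left self-injective ring realises every functional
    left-linear relation by a right multiplication
    ([functional_submodule_mulr]), and here every simple left module embeds in
    the ring ([right_annihilator_neq0]). So every [x] in [I] has a nonzero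
    [h x] annihilated by all [a] with [a x] in [J^2], and for every subset [D]
    of [I] some [a] satisfies [x a = h x] for [x] in [D] and [x a = 0] for the
    other [x] in [I] ([exists_indicator_factors]). Such a family of elements
    cannot lie in a [K]-space with no more than [#|I|] generators: a diagonal
    construction produces a [D] that is missed ([simple_generators_finite]).

    That the simple modules embed in [A] amounts to the faithfulness of the
    left socle [S] as a left module over [A / J]. It is faithful as a right
    module ([right_annihilator_left_socle]). Send a two-sided ideal [T] above
    [J] to the left annihilator of [S T]. Self-injectivity makes this
    decreasing map injective ([socle_annK]). Applied twice to [J] it gives the
    left annihilator of [S]; if that were larger than [J], iterating would give
    a strictly increasing sequence of ideals of the semisimple ring [A / J].

    As for the two dimension conditions, [A / J] is a finite sum of simple
    modules, and every simple module is a quotient of it. *)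

(** * Finite sequences over an infinite set *)

Definition lists_over (T : eqType) (D : set T) (s : seq T) : Prop :=
  forall x, x \in s -> D x.

Section CardinalArithmetic.
Variable T : eqType.
Implicit Types (D E : set T) (s : seq T).

(** A maximal partial matching between [D] and [E] exhausts one of them. *)
Lemma card_comparable D E :
  (exists f : T -> T, (forall x, D x -> E (f x)) /\
     forall x y, D x -> D y -> f x = f y -> x = y) \/
  (exists f : T -> T, (forall x, E x -> D (f x)) /\
     forall x y, E x -> E y -> f x = f y -> x = y).
Proof.
pose P (M : set (T * T)) := (forall p, M p -> D p.1 /\ E p.2) /\
  (forall p q, M p -> M q -> p.1 = q.1 <-> p.2 = q.2).
have [F FP Ftot|M [[MDE Mbij] Mmax]] := @Zorn_bigcup _ P.
  split=> [p [X FX Xp]|p q [X FX Xp] [Y FY Yq]]; first exact: (FP X FX).1.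
  have [XY|YX] := Ftot X Y FX FY.
    by apply: (FP Y FY).2 => //; apply: XY.
  by apply: (FP X FX).2 => //; apply: YX.
have [MD|/existsNP[x0 /not_implyP[Dx0 Mx0]]] :=
  pselect (forall x, D x -> exists y, M (x, y)).
  left; have /choice[f fP] x : exists y, D x -> M (x, y).
    by have [/MD[y]|nDx] := pselect (D x); [exists y|exists x].
  exists f; split=> [x Dx|x y Dx Dy fxy]; first exact: (MDE _ (fP x Dx)).2.
  exact: (Mbij _ _ (fP x Dx) (fP y Dy)).2.
right.
have ME y : E y -> exists x, M (x, y).
  move=> Ey; apply: contrapT => nM; apply: (Mmax (M `|` [set (x0, y)])).
    split; first by move=> ?; left.
    by move=> /(_ (x0, y) (or_intror erefl)) Mxy; apply: nM; exists x0.
  have new1 p : M p -> p.1 <> x0.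
    by case: p => a b /= Mab ax0; apply: Mx0; exists b; rewrite -ax0.
  have new2 p : M p -> p.2 <> y.
    by case: p => a b /= Mab bq; apply: nM; exists a; rewrite -bq.
  split=> [p [/MDE//|-> //]|p q [Mp|->] [Mq|->] //=]; first exact: Mbij.
    by split=> [/(new1 _ Mp)|/(new2 _ Mp)].
  by split=> /esym => [/(new1 _ Mq)|/(new2 _ Mq)].
have /choice[f fP] y : exists x, E y -> M (x, y).
  by have [/ME[x]|nEy] := pselect (E y); [exists x|exists y].
exists f; split=> [y Ey|x y Ex Ey fxy]; first exact: (MDE _ (fP y Ey)).1.
exact: (Mbij _ _ (fP x Ex) (fP y Ey)).1.
Qed.

(** The graphs of the injections from the nonempty sequences over some [D] to
    [D]; the graph determines [D]. Without the restriction to nonempty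
    sequences the empty graph, where [D] is empty, would not qualify, and the
    empty chain would have no upper bound. *)
Let coding (G : set (seq T * T)) :=
  let D := [set x | exists z, G ([:: x], z)] in
  [/\ forall s, (exists z, G (s, z)) <-> s != [::] /\ lists_over D s,
      forall p, G p -> D p.2 &
      forall p q, G p -> G q -> p.1 = q.1 <-> p.2 = q.2].

Let coding_bigcup (F : set (set (seq T * T))) :
  F `<=` coding -> total_on F subset -> coding (\bigcup_(X in F) X).
Proof.
move=> Fc Ftot; split=> [s|[s z] [X FX Xp]|p q [X FX Xp] [Y FY Yq]].
- split=> [[z [X FX Xsz]]|[s0 Ds]].
    have [Xdom _ _] := Fc X FX.
    have [s0 Xs] := (Xdom s).1 (ex_intro _ z Xsz); split=> // x /Xs[w Xw].
    by exists w, X.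
  have [X [FX Xs]] : exists X, F X /\
      lists_over [set x | exists z, X ([:: x], z)] s.
    elim: s s0 Ds => // x s IHs _ Ds.
    have [w [X FX Xxw]] := Ds x (mem_head x s).
    have [->|s0] := eqVneq s [::].
      by exists X; split=> // u; rewrite inE => /eqP->; exists w.
    have [|Y [FY Ys]] := IHs s0.
      by move=> u us; apply: Ds; rewrite inE us orbT.
    have [XY|YX] := Ftot X Y FX FY.
      exists Y; split=> // u; rewrite inE => /predU1P[->|/Ys//].
      by exists w; apply: XY.
    exists X; split=> // u; rewrite inE => /predU1P[->|/Ys[v Yv]].
      by exists w.
    by exists v; apply: YX.
  have [Xdom _ _] := Fc X FX.
  by have [z Xsz] := (Xdom s).2 (conj s0 Xs); exists z, X.
- by have [_ Xr _] := Fc X FX; have [w Xw] := Xr _ Xp; exists w, X.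
have [XY|YX] := Ftot X Y FX FY.
  by have [_ _ Yb] := Fc Y FY; apply: Yb => //; apply: XY.
by have [_ _ Xb] := Fc X FX; apply: Xb => //; apply: YX.
Qed.

(** The new values lie in [E], so they cannot collide with the old ones. *)
Let coding_extend G E (j : seq T -> T) :
  coding G -> E !=set0 ->
  let D := [set x | exists z, G ([:: x], z)] in
  (forall x, E x -> ~ D x) ->
  (forall s, s != [::] -> lists_over (D `|` E) s -> E (j s)) ->
  (forall s t, s != [::] -> t != [::] ->
     lists_over (D `|` E) s -> lists_over (D `|` E) t -> j s = j t -> s = t) ->
  exists2 G', G `<` G' & coding G'.
Proof.
move=> [Gdom Gr Gb] [x0 Ex0] D ED jE jinj.
pose N := [set p | [/\ p.1 != [::], lists_over (D `|` E) p.1,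
   ~ lists_over D p.1 & p.2 = j p.1]].
have over1 (B : set T) x : lists_over B [:: x] <-> B x.
  by split=> [|Bx y]; [apply; rewrite mem_head|rewrite inE => /eqP->].
have NE p : N p -> E p.2 by case: p => s z [/= s0 sDE _ ->]; apply: jE.
have GN p q : G p -> N q -> p.1 = q.1 <-> p.2 = q.2.
  move=> Gp Nq; split=> [pq|pq]; last first.
    by case: (ED _ (NE _ Nq)); rewrite -pq; apply: Gr.
  case: p q pq Gp Nq => s z [t w] /= -> Gtz [/= t0 tDE tD _].
  by case: tD; apply: ((Gdom t).1 (ex_intro _ z Gtz)).2.
have domE : [set x | exists z, (G `|` N) ([:: x], z)] = D `|` E.
  apply/seteqP; split=> x.
    by move=> [z [Gxz|[_ /over1 //]]]; left; exists z.
  move=> [[z Gxz]|Ex]; first by exists z; left.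
  exists (j [:: x]); right; split=> //; first by apply/over1; right.
  by move=> /over1; apply: ED.
exists (G `|` N).
  split=> [p Gp|GNG]; first by left.
  have [z Gz] : exists z, G ([:: x0], z).
    exists (j [:: x0]); apply: GNG; right; split=> //=.
      by apply/over1; right.
    by move=> /over1; apply: ED.
  by apply: (ED x0) => //; exists z.
rewrite /coding domE; split=> [s|p [Gp|Np]|p q [Gp|Np] [Gq|Nq]].
- split=> [[z [Gsz|[/= s0 sDE _ _]]]|[s0 sDE]]; last 2 first.
  + by split.
  + have [sD|sD] := pselect (lists_over D s); last by exists (j s); right.
    by have [z Gz] := (Gdom s).2 (conj s0 sD); exists z; left.
  have [s0 sD] := (Gdom s).1 (ex_intro _ z Gsz).
  by split=> // x /sD; left.
- by left; apply: Gr.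
- by right; apply: NE.
- exact: Gb.
- exact: GN.
- by split=> /esym pq; apply/esym; apply/(GN q p).
case: p q Np Nq => s z [t w] [/= s0 sDE _ ->] [/= t0 tDE _ ->].
by split=> [->//|]; apply: jinj.
Qed.

(** Take a maximal coding, with its set [D]. It is nonempty, as otherwise a
    countable subset could be added. If [D] were no more numerous than its
    complement, then a copy [E] of [D] could be added: sequences over the union
    of [D] and [E] are coded by sequences over [D], hence by elements of [E].
    So the complement embeds in [D], the whole type embeds in [D], and its
    sequences are coded by sequences over [D]. *)
Lemma inj_seq_infinite : infinite_set [set: T] ->
  exists f : seq T -> T, injective f.
Proof.
move=> /infiniteP/card_leP[g0].
pose g n := val (g0 (SigSub (mem_setT n))).
have ginj : injective g.
  by move=> m n /val_inj; move/(@injT _ _ g0) => [].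
have [G [Gc Gmax]] := Zorn_bigcup coding_bigcup.
have [Gdom Gr Gb] := Gc.
set D := [set x | exists z, G ([:: x], z)] in Gdom Gr.
have nodisj E (j : seq T -> T) : E !=set0 -> (forall x, E x -> ~ D x) ->
    (forall s, s != [::] -> lists_over (D `|` E) s -> E (j s)) ->
    ~ (forall s t, s != [::] -> t != [::] ->
      lists_over (D `|` E) s -> lists_over (D `|` E) t -> j s = j t -> s = t).
  move=> E0 ED jE jinj.
  by have [G' GG' /Gmax] := coding_extend Gc E0 ED jE jinj.
have map_inj (U : eqType) (B : set T) (q : T -> U) s t :
    (forall x y, B x -> B y -> q x = q y -> x = y) ->
    lists_over B s -> lists_over B t -> map q s = map q t -> s = t.
  move=> qinj; elim: s t => [|x s IHs] [|y t] //= sB tB [qxy qst].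
  congr (_ :: _).
    by apply: qinj => //; [apply/sB/mem_head|apply/tB/mem_head].
  by apply: IHs qst => u us; [apply: sB|apply: tB]; rewrite inE us orbT.
have [x0 Dx0] : D !=set0.
  apply/set0P/eqP => D0.
  have /choice[g' g'P] x : exists n, range g x -> g n = x.
    have [[n _ <-]|nx] := pselect (range g x); last by exists 0%N.
    by exists n.
  have over s : lists_over (D `|` range g) s -> lists_over (range g) s.
    by rewrite D0 set0U.
  apply: (nodisj (range g) (fun s => g (pickle (map g' s)))) => //.
  - by exists (g 0%N), 0%N.
  - by move=> x _; rewrite D0.
  move=> s t s0 t0 sR tR st.
  apply: (@map_inj _ (range g) g') (over _ sR) (over _ tR) _.
    by move=> x y Rx Ry e; rewrite -(g'P x Rx) -(g'P y Ry) e.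
  exact: (pcan_inj pickleK (ginj _ _ st)).
have /choice[c cP] s : exists z, s != [::] -> lists_over D s -> G (s, z).
  have [[s0 sD]|nsD] := pselect (s != [::] /\ lists_over D s).
    by have [z Gz] := (Gdom s).2 (conj s0 sD); exists z.
  by exists x0 => s0 sD; case: nsD.
have cD s : s != [::] -> lists_over D s -> D (c s).
  by move=> s0 sD; apply: (Gr _ (cP s s0 sD)).
have cinj s t : s != [::] -> t != [::] -> lists_over D s -> lists_over D t ->
    c s = c t -> s = t.
  by move=> s0 t0 sD tD; apply: (Gb _ _ (cP s s0 sD) (cP t t0 tD)).2.
have over1 x : D x -> lists_over D [:: x] by move=> Dx y; rewrite inE => /eqP->.
have over2 x : D x -> lists_over D [:: x; x].
  by move=> Dx y; rewrite !inE => /orP[]/eqP->.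
have mapD (B : set T) (q : T -> T) s : (forall x, B x -> D (q x)) ->
    lists_over B s -> lists_over D (map q s).
  by move=> qD sB x /mapP[y ys ->]; apply: qD; apply: sB.
have [[i [iE iinj]]|[k [kD kinj]]] := card_comparable D (~` D).
  exfalso; pose E := [set i x | x in D].
  have /choice[i' i'P] y : exists x, E y -> D x /\ i x = y.
    have [[x Dx xy]|nEy] := pselect (E y); last by exists x0 => /nEy.
    by exists x.
  (* The length of the coded sequence tells the two parts of the union apart. *)
  pose q x := if `[< D x >] then c [:: x] else c [:: i' x; i' x].
  have qD x : (D `|` E) x -> D (q x).
    rewrite /q => xDE; case: asboolP => Dx; first exact/cD/over1.
    by case: xDE => // /i'P[Di _]; apply/cD/over2.
  have ED x : E x -> ~ D x by move=> [y Dy <-]; apply: iE.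
  have qinj x y : (D `|` E) x -> (D `|` E) y -> q x = q y -> x = y.
    rewrite /q => xDE yDE; case: asboolP => Dx; case: asboolP => Dy.
    - by move/cinj => H; case: (H isT isT (over1 _ Dx) (over1 _ Dy)).
    - have Ey : E y by case: yDE.
      by move/cinj => H; case: (H isT isT (over1 _ Dx) (over2 _ (i'P y Ey).1)).
    - have Ex : E x by case: xDE.
      by move/cinj => H; case: (H isT isT (over2 _ (i'P x Ex).1) (over1 _ Dy)).
    have Ex : E x by case: xDE.
    have Ey : E y by case: yDE.
    have [[Dx' ix] [Dy' iy]] := (i'P x Ex, i'P y Ey).
    move/cinj => H; case: (H isT isT (over2 _ Dx') (over2 _ Dy')) => // e _.
    by rewrite -ix -iy e.
  apply: (nodisj E (fun s => i (c (map q s)))) => //.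
  + by exists (i x0), x0.
  + move=> s s0 sDE; exists (c (map q s)) => //.
    by apply: cD; [case: s s0 {sDE}|apply: mapD sDE].
  move=> s t s0 t0 sDE tDE /iinj e; apply: (map_inj _ _ _ _ _ qinj sDE tDE).
  have [s0' t0'] : map q s != [::] /\ map q t != [::].
    by split; [case: (s) s0|case: (t) t0].
  have sD := mapD _ _ _ qD sDE; have tD := mapD _ _ _ qD tDE.
  by apply: cinj => //; apply: e; apply: cD.
pose q x := if `[< D x >] then c [:: x] else c [:: k x; k x].
have qD x : D (q x).
  rewrite /q; case: asboolP => Dx; first exact/cD/over1.
  exact/cD/over2/kD.
have qinj x y : q x = q y -> x = y.
  rewrite /q; case: asboolP => Dx; case: asboolP => Dy.
  - by move/cinj => H; case: (H isT isT (over1 _ Dx) (over1 _ Dy)).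
  - by move/cinj => H; case: (H isT isT (over1 _ Dx) (over2 _ (kD y Dy))).
  - by move/cinj => H; case: (H isT isT (over2 _ (kD x Dx)) (over1 _ Dy)).
  move/cinj => H; have := H isT isT (over2 _ (kD x Dx)) (over2 _ (kD y Dy)).
  by case=> // e _; apply: kinj.
(* Prepending [x0] brings the empty sequence into the domain of [c]. *)
exists (fun s => c (x0 :: map q s)) => s t /cinj H.
have mapx0 u : lists_over D (x0 :: map q u).
  by move=> z; rewrite inE => /predU1P[->//|/mapP[y _ ->]]; apply: qD.
have [] := H isT isT (mapx0 s) (mapx0 t).
by apply: inj_map => x y; apply: qinj.
Qed.

End CardinalArithmetic.

(** * Submodules and spans *)

Section Submodules.
Variables (R : pzRingType) (M : lmodType R).
Implicit Types (N X : set M) (x y : M).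

Lemma submoduleP N :
  submodule N <-> N 0 /\ (forall a x y, N x -> N y -> N (a *: x + y)).
Proof.
split=> [[N0 Nl]|[N0 Nl]].
  split; first by move: N0; rewrite !inE.
  by move=> a x y Nx Ny; have := Nl a x y; rewrite !inE; apply.
split; first by rewrite !inE.
by move=> a x y; rewrite !inE; apply: Nl.
Qed.

Section Closure.
Variables (N : set M) (sN : submodule N).

Lemma submod0 : N 0. Proof. by have [] := (submoduleP N).1 sN. Qed.

Lemma submodD x y : N x -> N y -> N (x + y).
Proof.
by move=> Nx Ny; rewrite -[x]scale1r; apply: ((submoduleP N).1 sN).2.
Qed.

Lemma submodZ a x : N x -> N (a *: x).
Proof.
move=> Nx; rewrite -[_ *: _]addr0; apply: ((submoduleP N).1 sN).2 => //.
exact: submod0.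
Qed.

Lemma submodN x : N x -> N (- x).
Proof. by move=> Nx; rewrite -scaleN1r; apply: submodZ. Qed.

Lemma submodB x y : N x -> N y -> N (x - y).
Proof. by move=> Nx Ny; apply: submodD => //; apply: submodN. Qed.

Lemma submod_sum (I : Type) (r : seq I) (P : pred I) (F : I -> M) :
  (forall i, P i -> N (F i)) -> N (\sum_(i <- r | P i) F i).
Proof. by move=> NF; apply: big_ind => //; [apply: submod0|apply: submodD]. Qed.

(** The closure proof is an argument of the predicate, so that the submodule is
    an [lmodType] in its own right. *)
Definition submod_pred of submodule N : {pred M} := [in N].
Definition submod_type := {x : M | x \in submod_pred sN}.
HB.instance Definition _ :=
  GRing.isSubmodClosed.Build R M (submod_pred sN) (GRing.submod_closed_semi sN).
HB.instance Definition _ := SubChoice.on submod_type.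
HB.instance Definition _ := [SubChoice_isSubLmodule of submod_type by <:].

Lemma submod_val_linear a (u v : submod_type) :
  val (a *: u + v) = a *: val u + val v.
Proof. by rewrite linearP. Qed.

End Closure.

Definition span X : set M :=
  [set x | forall N, submodule N -> X `<=` N -> N x].

Lemma span_submod X : submodule (span X).
Proof.
apply/submoduleP; split=> [N sN _|a x y Xx Xy N sN XN]; first exact: submod0.
by apply: ((submoduleP N).1 sN).2; [apply: Xx|apply: Xy].
Qed.

Lemma sub_span X : X `<=` span X.
Proof. by move=> x Xx N _; apply. Qed.

Lemma span_min X N : submodule N -> X `<=` N -> span X `<=` N.
Proof. by move=> sN XN x; apply. Qed.

Lemma spanS X Y : X `<=` Y -> span X `<=` span Y.
Proof.
move=> XY; apply: span_min; first exact: span_submod.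
exact: subset_trans XY (@sub_span Y).
Qed.

Lemma span_sums X x : span X x ->
  exists n (c : 'I_n -> R) (e : 'I_n -> M),
    (forall i, X (e i)) /\ x = \sum_(i < n) c i *: e i.
Proof.
apply: (span_min (N := [set x | exists n (c : 'I_n -> R) (e : 'I_n -> M),
    (forall i, X (e i)) /\ x = \sum_(i < n) c i *: e i])); last first.
  move=> y Xy; exists 1%N, (fun=> 1), (fun=> y).
  by rewrite big_ord1 scale1r.
apply/submoduleP; split.
  by exists 0%N, (fun=> 0), (fun=> 0); split; [case|rewrite big_ord0].
move=> a _ _ [n [c [e [Xe ->]]]] [m [d [f [Xf ->]]]].
exists (n + m)%N,
  (fun i : 'I_(n + m) =>
     match fintype.split i with inl j => a * c j | inr k => d k end),
  (fun i : 'I_(n + m) =>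
     match fintype.split i with inl j => e j | inr k => f k end).
split=> [i|]; first by case: fintype.split.
rewrite big_split_ord scaler_sumr; congr (_ + _); apply: eq_bigr => i _.
  by rewrite (unsplitK (inl i)) scalerA.
by rewrite (unsplitK (inr i)).
Qed.

End Submodules.

Notation lspan A := (@span A A^o).

(** * Right multiplications in a left self-injective ring *)

Section SelfInjective.
Variables (R : pzRingType) (injR : left_self_injective R).

(** The two projections of [N] are left-linear maps to [R]; the first one is
    injective, so the second one factors through it, and left-linear maps from
    [R] to [R] are right multiplications. *)
Lemma functional_submodule_mulr (N : set (R^o * R^o)) : submodule N ->
  (forall y, N (0, y) -> y = 0) ->
  exists a : R, forall x y : R, N (x, y) -> y = x * a.
Proof.
move=> sN Nfun.
pose i (u : submod_type sN) : R^o := (val u).1.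
pose f (u : submod_type sN) : R^o := (val u).2.
have ilin : linear i by move=> a u v; rewrite /i submod_val_linear.
have flin : linear f by move=> a u v; rewrite /f submod_val_linear.
pose il := GRing.isLinear.Build R _ _ _ i ilin.
pose fl := GRing.isLinear.Build R _ _ _ f flin.
pose iL : {linear submod_type sN -> R^o} := HB.pack i il.
pose fL : {linear submod_type sN -> R^o} := HB.pack f fl.
have iinj : injective iL.
  move=> u v uv; apply: val_inj; apply/eqP; rewrite -subr_eq0; apply/eqP.
  have Nuv : N (val u - val v).
    by apply: (submodB sN); [move: (valP u)|move: (valP v)]; rewrite inE.
  move: uv Nuv; rewrite /iL /= /i {iL fL il fl ilin flin}.
  case: u v => [[u1 u2] uN] [[v1 v2] vN] /= ->.
  have -> : (v1, u2) - (v1, v2) = (0, u2 - v2) :> R^o * R^o.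
    by rewrite -(subrr v1).
  by move=> /Nfun ->.
have [g gP] := injR fL iinj.
exists (g 1) => x y Nxy.
have Nm : (x, y) \in submod_pred sN by rewrite inE.
have := gP (exist _ (x, y) Nm); rewrite /iL /fL /= /i /f /= => <-.
by have := linearZ_LR g x 1; rewrite /GRing.scale /= mulr1.
Qed.

Lemma annihilator_le_mulr (v w : R) :
  (forall a, a * v = 0 -> a * w = 0) -> exists y, w = v * y.
Proof.
move=> vw; pose N : set (R^o * R^o) := [set p | exists a, p = (a * v, a * w)].
have sN : submodule N.
  apply/submoduleP; split; first by exists 0; rewrite !mul0r.
  move=> b _ _ [c ->] [d ->]; exists (b * c + d).
  by rewrite !(mulrDl (b * c)) -!(mulrA b).
have [|y yP] := functional_submodule_mulr sN.
  by move=> y [a []] av0 ->; apply: vw.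
by exists y; apply: yP; exists 1; rewrite !mul1r.
Qed.

End SelfInjective.

(** * The semisimple quotient, seen from the ring *)

(** An element that is zero in the quotient by [P] qualifies as well, which
    makes the condition stable under left multiplication. *)
Definition simple_mod (A : pzRingType) (P : set A) (x : A) : Prop :=
  forall a, ~ P (a * x) -> exists b, P (b * (a * x) - x).

Lemma left_ideal_colon (A : pzRingType) (L : set A) (r : A) :
  left_ideal L -> left_ideal [set a | L (a * r)].
Proof.
move=> lL; apply/left_idealP; split=> [|a x y Lx Ly] /=.
  by rewrite mul0r; apply: (left_ideal0 lL).
rewrite mulrDl -mulrA; apply: (left_idealD lL) => //.
exact: (left_idealM lL).
Qed.

(** The sum of [P] and [A x]. *)
Definition adjoin (A : pzRingType) (P : set A) (x : A) : set A :=
  [set z | exists a, P (z - a * x)].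

Section Adjoin.
Variables (A : pzRingType) (P : set A) (x : A).
Hypothesis lP : left_ideal P.

Lemma adjoin_left_ideal : left_ideal (adjoin P x).
Proof.
apply/left_idealP; split.
  by exists 0; rewrite mul0r subrr; apply: (left_ideal0 lP).
move=> d y z [b Py] [c Pz]; exists (d * b + c).
have -> : d * y + z - (d * b + c) * x = d * (y - b * x) + (z - c * x).
  by rewrite mulrBr mulrDl mulrA opprD addrACA.
by apply: (left_idealD lP) => //; apply: (left_idealM lP).
Qed.

Lemma sub_adjoin : P `<=` adjoin P x.
Proof. by move=> z Pz; exists 0; rewrite mul0r subr0. Qed.

Lemma mem_adjoin : adjoin P x x.
Proof. by exists 1; rewrite mul1r subrr; apply: (left_ideal0 lP). Qed.

End Adjoin.

Section SemisimpleTop.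
Variable A : pzRingType.
Local Notation J := (@jacobson A).
Hypothesis ssB : semisimple_ring (jacobson_quotient A).
Let lJ : left_ideal J := jacobson_left_ideal A.

(** In [A / J], decompose [1] along the image of [L] and a complement of it, and
    let [e] lift the second component. For [l] in [L], the class of [l e] lies
    in the complement, and also in the image of [L] since
    [l e = l - l (1 - e)]. *)
Lemma complement_mod_jacobson (L : set A) : left_ideal L -> J `<=` L ->
  exists e, L (1 - e) /\ forall l, L l -> J (l * e).
Proof.
move=> lL JL.
pose N : set (jacobson_quotient A)^o := [set jacobson_proj x | x in L].
have sN : submodule N.
  apply/submoduleP; split.
    by exists 0; [apply: left_ideal0|rewrite raddf0].
  move=> q _ _ [x Lx <-] [y Ly <-]; have [a ->] := jacobson_proj_surj q.
  exists (a * x + y); first by apply: left_idealD => //; apply: left_idealM.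
  by rewrite raddfD /= rmorphM.
have [N' [sN' NN' BN]] := ssB sN.
have [_ [z [[l0 Ll0 <-] N'z e1]]] := BN (jacobson_proj 1).
have [e ze] := jacobson_proj_surj z.
have J1 : J (1 - l0 - e).
  have /jacobson_projP : jacobson_proj 1 = jacobson_proj (l0 + e).
    by rewrite e1 ze raddfD.
  by rewrite opprD addrA.
exists e; split=> [|l Ll].
  rewrite -[1 - e](subrK (1 - l0 - e)).
  apply: left_idealD => //; last exact: JL.
  by rewrite opprB addrA subrK subKr.
have : (N `&` N') (jacobson_proj (l * e)).
  split; last by rewrite rmorphM /= -ze; apply: (submodZ sN' (jacobson_proj l)).
  exists (l * l0 * -1 + l).
    rewrite mulrN1; apply: left_idealD => //.
    by rewrite -mulNr; apply: left_idealM.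
  apply/jacobson_projP.
  have -> : l * l0 * -1 + l - l * e = l * (1 - l0 - e).
    by rewrite !mulrBr mulr1 mulrN1 [- _ + l]addrC.
  exact: (left_idealM lJ).
rewrite NN' => /= le0; rewrite -[l * e]subr0.
by apply/jacobson_projP; rewrite le0 raddf0.
Qed.

Lemma regular_mod_jacobson (x : A) : exists b, J (x - x * b * x).
Proof.
have lL := adjoin_left_ideal x lJ.
have [e [[b Jb] Le]] := complement_mod_jacobson lL (@sub_adjoin _ J x).
exists b; have Jxe : J (x * e) := Le _ (mem_adjoin x lJ).
have -> : x - x * b * x = x * (1 - e - b * x) + x * e.
  by rewrite !mulrBr mulr1 mulrA addrAC subrK.
by apply: (left_idealD lJ) => //; apply: (left_idealM lJ).
Qed.

Lemma simple_modM (P : set A) (a x : A) :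
  left_ideal P -> simple_mod P x -> simple_mod P (a * x).
Proof.
move=> lP Px c nP; have [|b Pb] := Px (c * a); first by rewrite -mulrA.
exists (a * b).
have -> : a * b * (c * (a * x)) - a * x = a * (b * (c * a * x) - x).
  by rewrite mulrBr !mulrA.
exact: left_idealM.
Qed.

(** Otherwise the left ideal spanned by the elements that are simple modulo
    [J] lies in a maximal left ideal, and modulo [J] a complement of that ideal
    is generated by one more such element. *)
Lemma one_sum_simple : exists n (u : 'I_n -> A),
  (forall i, simple_mod J (u i)) /\ 1 = \sum_(i < n) u i.
Proof.
pose P := [set x | simple_mod J x].
suff /span_sums[n [c [u [Pu ->]]]] : lspan A P 1.
  exists n, (fun i => c i * u i); split=> // i.
  exact: (simple_modM lJ (Pu i)).
apply: contrapT => nP1.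
have lP : left_ideal (lspan A P) := @span_submod A A^o P.
have JP : J `<=` lspan A P.
  by move=> j Jj; apply: sub_span => a nJ; case: nJ; apply: (left_idealM lJ).
have [e [P1e Pe]] := complement_mod_jacobson lP JP.
have : ~ J e.
  move=> Je; apply: nP1; rewrite -[1](subrK e).
  by apply: (left_idealD lP) => //; apply: JP.
move=> /existsNP[m /not_implyP[mm me]].
(* [e] annihilates the span of [P] modulo [J], so the translate of [m] by [e]
   contains that span. *)
have [lm m1 mmax] := maximal_left_ideal_colon mm me.
set L := [set a | m (a * e)] in lm m1 mmax.
have PL : lspan A P `<=` L by move=> x Px; apply: Pe.
have [f [L1f Lf]] := complement_mod_jacobson lm (subset_trans JP PL).
have nL1 : ~ L 1.
  move=> L1; apply: m1; apply/seteqP; split=> // x _.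
  by rewrite -[x]mulr1; apply: (left_idealM lm).
suff Pf : P f.
  apply: nL1; rewrite -[1](subrK f); apply: (left_idealD lm L1f).
  by apply: PL; apply: sub_span.
move=> a nJaf.
have lL' := adjoin_left_ideal a lm.
have [L'E|L'T] := mmax _ lL' (@sub_adjoin _ L a).
  by case: nJaf; apply: Lf; rewrite -L'E; apply: mem_adjoin.
have [b Lb] : adjoin L a 1 by rewrite L'T.
exists b; have -> : b * (a * f) - f = - 1 * ((1 - b * a) * f).
  by rewrite mulN1r mulrBl mul1r mulrA opprB.
by apply: (left_idealM lJ) => //; apply: Lf.
Qed.

End SemisimpleTop.

(** * Powers of the radical *)

Section JacobsonPowers.
Variable A : pzRingType.
Local Notation J := (@jacobson A).
Let lJ : left_ideal J := jacobson_left_ideal A.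

Fixpoint jpow (n : nat) : set A :=
  if n is m.+1 then lspan A [set z | exists x y, [/\ J x, jpow m y & z = x * y]]
  else setT.

Lemma jpow_left_ideal n : left_ideal (jpow n).
Proof. by case: n => [|n]; [apply/left_idealP|apply: (@span_submod A A^o)]. Qed.

Lemma jpow1 : jpow 1 = J.
Proof.
apply/seteqP; split.
  apply: (span_min (M := A^o) lJ) => _ [x [y [Jx _ ->]]].
  exact: jacobson_right.
by move=> x Jx; apply: sub_span; exists x, 1; rewrite mulr1.
Qed.

Lemma jpowMJ n x y : J x -> jpow n y -> jpow n.+1 (x * y).
Proof. by move=> Jx Jy; apply: sub_span; exists x, y. Qed.

Lemma jpowM m n x y : jpow m x -> jpow n y -> jpow (m + n) (x * y).
Proof.
elim: m x => [|m IHm] x Jx Jy; first exact: (left_idealM (jpow_left_ideal n)).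
have lI := left_ideal_colon y (jpow_left_ideal (m.+1 + n)).
apply: (span_min (M := A^o) lI) Jx => _ [u [v [Ju Jv ->]]] /=.
by rewrite -mulrA; apply: jpowMJ => //; apply: IHm.
Qed.

Lemma jpowS n : jpow n.+1 `<=` jpow n.
Proof.
apply: (span_min (M := A^o) (jpow_left_ideal n)) => _ [x [y [_ Jy ->]]].
exact: (left_idealM (jpow_left_ideal n)).
Qed.

Lemma jpow_eq0 : jacobson_nilpotent A -> exists n, jpow n = [set 0].
Proof.
move=> [n nil]; exists n; apply/seteqP; split; last first.
  by move=> _ ->; apply: (left_ideal0 (jpow_left_ideal n)).
suff jpowZ m k : (k + m)%N = n -> forall y, jpow m y ->
    forall x : 'I_k -> A, (forall i, J (x i)) ->
    forall a, \prod_i x i * (a * y) = 0.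
  move=> y Jy; have := jpowZ n 0%N erefl y Jy (fun=> 0) _ 1.
  by rewrite big_ord0 !mul1r; apply; case.
elim: m k => [|m IHm] k kmn.
  by rewrite -kmn addn0 in nil => y _ x Jx a; rewrite nil ?mul0r.
move=> y; apply: (span_min (M := A^o) (N := [set y | forall x : 'I_k -> A,
    (forall i, J (x i)) -> forall a, \prod_i x i * (a * y) = 0])).
  apply/left_idealP; split=> [x _ a|b u v Ju Jv x Jx a].
    by rewrite !mulr0.
  by rewrite !mulrDr [a * (b * u)]mulrA Ju // Jv // addr0.
move=> _ [u [v [Ju Jv ->]]] x Jx a /=.
pose x' (i : 'I_k.+1) := if unlift ord_max i is Some j then x j else a * u.
have := IHm k.+1 _ v Jv x' _ 1; rewrite big_ord_recr /= mul1r => <-.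
- rewrite /x' unlift_none -!mulrA; congr (_ * _); apply: eq_bigr => i _.
  suff -> : widen_ord (leqnSn k) i = lift ord_max i by rewrite liftK.
  by apply: val_inj; rewrite [RHS]lift_max.
- by rewrite addSnnS.
move=> i; rewrite /x'; case: unliftP => [j _|_]; first exact: Jx.
exact: (left_idealM lJ).
Qed.

Lemma simple_mod_jpowS n u x :
  simple_mod J u -> jpow n x -> simple_mod (jpow n.+1) (u * x).
Proof.
move=> su Jx a nJ; have [|b Jb] := su a.
  by move=> Jau; apply: nJ; rewrite mulrA; apply: jpowMJ.
exists b; have -> : b * (a * (u * x)) - u * x = (b * (a * u) - u) * x.
  by rewrite mulrBl !mulrA.
exact: jpowMJ.
Qed.

End JacobsonPowers.

(** * The socle *)

Section Socle.
Variable A : pzRingType.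
Local Notation J := (@jacobson A).
Hypothesis ssB : semisimple_ring (jacobson_quotient A).
Hypothesis nilJ : jacobson_nilpotent A.
Hypothesis injA : left_self_injective A.
Let lJ : left_ideal J := jacobson_left_ideal A.

(** As [A / J] is semisimple, the elements killed by [J] are those of the
    largest semisimple submodule. *)
Definition left_socle : set A := [set s | forall j, J j -> j * s = 0].
Local Notation S := left_socle.

Lemma left_socle_left_ideal : left_ideal S.
Proof.
apply/left_idealP; split=> [j _|a x y Sx Sy j Jj]; first by rewrite mulr0.
by rewrite mulrDr mulrA Sx ?Sy ?addr0 //; apply: jacobson_right.
Qed.
Let lS := left_socle_left_ideal.

(** Multiply [a] by elements of [J] as long as the product does not vanish. *)
Lemma left_socle_essential (a : A) :
  a <> 0 -> exists c, c * a <> 0 /\ S (c * a).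
Proof.
move=> a0; apply: contrapT => nex.
have [n Jn0] := jpow_eq0 nilJ.
suff /(_ n)[c] : forall n, exists c, jpow n c /\ c * a <> 0.
  by rewrite Jn0 => -[-> ]; rewrite mul0r.
elim=> [|m [c [Jc ca0]]]; first by exists 1; rewrite mul1r.
have : ~ S (c * a) by move=> Sca; apply: nex; exists c.
move=> /existsNP[j /not_implyP[Jj jca]]; exists (j * c).
by rewrite -mulrA; split=> //; apply: jpowMJ.
Qed.

(** It is enough to treat a simple [A v] with [v] in [S]. If [v x <> 0], then
    right multiplication by [x] is injective on [A v], so its inverse is a
    right multiplication by some [y], and [v = v (x y)] with [x y] nilpotent. *)
Lemma left_socle_mul_jacobson s x : S s -> J x -> s * x = 0.
Proof.
move=> Ss Jx; have [n [u [su u1]]] := one_sum_simple ssB.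
rewrite -[s]mul1r u1 !mulr_suml; apply: big1 => i _.
set v := u i * s; apply: contrapT => vx0.
have Jv a : J a -> a * v = 0.
  by move=> Ja; rewrite /v mulrA Ss //; apply: jacobson_right.
have [a avx0|y vE] := @annihilator_le_mulr _ injA (v * x) v.
  apply: contrapT => av0; have [|b Jb] := su i a.
    by move=> Jau; apply: av0; rewrite /v mulrA Ss.
  apply: vx0; have -> : v = b * (a * v).
    apply/eqP; rewrite eq_sym -subr_eq0 /v; apply/eqP.
    by rewrite !mulrA -mulrBl Ss // -mulrA.
  by rewrite -(mulrA b) -(mulrA a) avx0 mulr0.
have vn m : v = v * (x * y) ^+ m.
  by elim: m => [|m IHm]; rewrite ?mulr1 // exprS mulrA [v * (x * y)]mulrA -vE.
have [m nil] := nilJ.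
have := nil (fun=> x * y) (fun=> jacobson_right y Jx).
rewrite prodr_const card_ord => xym.
by apply: vx0; rewrite (vn m) xym mulr0 mul0r.
Qed.

(** If [S x = 0] then no [a <> 0] satisfies [a = a x y], so [1 - x y] is right
    invertible for every [y]; taking for [y] a quasi-inverse of [x] modulo [J]
    makes [1 - x y] idempotent, hence equal to [1], modulo [J]. *)
Lemma right_annihilator_left_socle x : (forall s, S s -> s * x = 0) -> J x.
Proof.
move=> Sx; have [b Jb] := regular_mod_jacobson ssB x.
pose g := 1 - x * b.
have [a ag0|z gz1] := @annihilator_le_mulr _ injA g 1.
  rewrite mulr1; apply: contrapT => a0.
  have [c [ca0 Sca]] := left_socle_essential a0.
  apply: ca0; have aE : a = a * x * b.
    by apply/eqP; rewrite -subr_eq0 -mulrA -{1}[a]mulr1 -mulrBr; apply/eqP.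
  by rewrite aE !mulrA -(mulrA c) [c * _]mulrA (Sx (c * a)) ?mul0r // mulrA.
have Jgg : J (g * g - g).
  have -> : g * g - g = (x - x * b * x) * - b.
    rewrite {1}/g mulrBl mul1r addrAC subrr add0r /g.
    by rewrite !mulrBr mulr1 mulrBl !mulrN !mulrA opprB opprK addrC.
  exact: jacobson_right.
have Jg1 : J (g - 1).
  have -> : g - 1 = (g * g - g) * z by rewrite mulrBl -mulrA -gz1 mulr1.
  exact: jacobson_right.
have Jxb : J (x * b).
  have -> : x * b = -1 * (g - 1) by rewrite /g mulN1r opprB opprB addrC subrK.
  exact: (left_idealM lJ).
rewrite -[x](subrK (x * b * x)); apply: (left_idealD lJ Jb).
exact: jacobson_right.
Qed.

Definition two_sided (T : set A) : Prop :=
  [/\ left_ideal T, J `<=` T & forall x r, T x -> T (x * r)].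

Definition socle_ann (T : set A) : set A :=
  [set c | forall s t, S s -> T t -> c * (s * t) = 0].

Lemma socle_ann_two_sided T : two_sided (socle_ann T).
Proof.
split=> [|j Jj s t Ss _|c r Tc s t Ss Tt].
- apply/left_idealP; split=> [s t _ _|a x y Tx Ty s t Ss Tt].
    by rewrite mul0r.
  by rewrite mulrDl -mulrA Tx // Ty // mulr0 addr0.
- by rewrite mulrA Ss ?mul0r.
by rewrite -mulrA mulrA -mulrA (mulrA r) Tc //; apply: (left_idealM lS).
Qed.

(** Modulo [J], a two-sided ideal [T] is generated by a central idempotent [t].
    If [b (1 - t)] were not in [J], there would be some [v <> 0] in
    [S b (1 - t)]. A complement [e] of its annihilator fixes [v], so [e] does
    not annihilate [S b], hence does not annihilate [S T], and [a v |-> a w]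
    is well defined for a nonzero [w] in [e S T]. This map is right
    multiplication by some [y], but [(1 - t) y t] lies in [J], and
    [S J = 0]. *)
Lemma socle_annK T b : two_sided T ->
  (forall c, socle_ann T c -> forall s, S s -> c * (s * b) = 0) -> T b.
Proof.
move=> [lT JT rT] Tb.
have [t [Tt Jt]] : exists t, T t /\ forall x, T x -> J (x - x * t).
  have [t' [Tt Jt']] := complement_mod_jacobson ssB lT JT.
  by exists (1 - t'); split=> // x /Jt'; rewrite mulrBr mulr1 subKr.
(* In the regular ring [A / J] the element [x = (1 - t) y t] is [x c x] for
   some [c], and [t c (1 - t)] is zero since [T] is two-sided. *)
have Jcorner y : J ((1 - t) * y * t).
  set x := _ * t; have [c Jc] := regular_mod_jacobson ssB x.
  rewrite -[x](subrK (x * c * x)); apply: (left_idealD lJ Jc).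
  have -> : x * c * x = (1 - t) * y * ((t * c - t * c * t) * (y * t)).
    have -> : t * c - t * c * t = t * c * (1 - t) by rewrite mulrBr mulr1.
    by rewrite /x !mulrA.
  by apply: (left_idealM lJ); apply: jacobson_right; apply: Jt; apply: rT.
apply: contrapT => nTb.
have nJ : ~ J (b * (1 - t)).
  move=> Jbt; apply: nTb; rewrite -[b](subrK (b * t)); apply: (left_idealD lT).
    by apply: JT; rewrite -[X in X - _]mulr1 -mulrBr.
  exact: (left_idealM lT).
have [s [Ss v0]] : exists s, S s /\ s * (b * (1 - t)) <> 0.
  apply: contrapT => nex; apply: nJ.
  apply: right_annihilator_left_socle => s Ss.
  by apply: contrapT => sb0; apply: nex; exists s.
set v := s * _ in v0; pose L := [set a | a * v = 0].
have lL : left_ideal L.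
  apply/left_idealP; split; first by rewrite /L /= mul0r.
  by move=> a x y Lx Ly; rewrite /L /= mulrDl -mulrA Lx Ly mulr0 addr0.
have JL : J `<=` L by move=> j Jj; rewrite /L /= /v mulrA Ss ?mul0r.
have [e [Le Je]] := complement_mod_jacobson ssB lL JL.
have ev : e * v = v.
  by apply/eqP; rewrite eq_sym -subr_eq0 -{1}[v]mul1r -mulrBl; apply/eqP.
have [s2 [x [Ss2 [Tx w0]]]] : exists s2 x, S s2 /\ (T x /\ e * (s2 * x) <> 0).
  apply: contrapT => nex; apply: v0.
  rewrite -ev /v (mulrA s) mulrA Tb ?mul0r //.
  move=> s2 x Ss2 Tx; apply: contrapT => w0; apply: nex; exists s2, x.
  by split=> //; split.
have [a av0|y wE] := @annihilator_le_mulr _ injA v (e * (s2 * x)).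
  by rewrite mulrA mulrA Ss2 ?mul0r //; apply: Je.
apply: w0; have -> : e * (s2 * x) = e * (s2 * x) * t.
  apply/eqP; rewrite -subr_eq0 -!mulrA -!mulrBr.
  by rewrite (left_socle_mul_jacobson Ss2) ?mulr0 //; apply: Jt.
rewrite wE /v -!mulrA left_socle_mul_jacobson //.
by apply: (left_idealM lJ); rewrite mulrA.
Qed.

Lemma socle_ann_inj T T' : two_sided T -> two_sided T' ->
  socle_ann T = socle_ann T' -> T = T'.
Proof.
suff sub U U' : two_sided U' -> socle_ann U = socle_ann U' -> U `<=` U'.
  by move=> tT tT' e; apply/seteqP; split; apply: sub.
move=> tU' e b Ub; apply: (socle_annK tU') => c; rewrite -e => Uc s Ss.
exact: Uc.
Qed.

Lemma socle_annS T T' : T `<=` T' -> socle_ann T' `<=` socle_ann T.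
Proof. by move=> TT' c Tc s t Ss /TT'; apply: Tc. Qed.

(** The ascending chain obtained from [J] by iterating [socle_ann] twice is
    stationary because [A / J] is noetherian; as [socle_ann] is injective, it is
    stationary from the start. Its second term is the left annihilator
    of [S]. *)
Lemma left_annihilator_left_socle c : (forall s, S s -> c * s = 0) -> J c.
Proof.
move=> cS; pose F T := socle_ann (socle_ann T).
pose I n := iter n F J.
have tI n : two_sided (I n).
  case: n => [|n]; last exact: socle_ann_two_sided.
  by split=> // x r; apply: jacobson_right.
have IS n : I n `<=` I n.+1.
  elim: n => [|n IHn]; first by have [] := tI 1%N.
  by apply: socle_annS; apply: socle_annS.
have Ile m n : (m <= n)%N -> I m `<=` I n.
  move=> /subnK <-; elim: (n - m)%N => [//|k IHk].
  by apply: subset_trans IHk _; apply: IS.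
pose U := \bigcup_n I n.
have lU : left_ideal U.
  apply/left_idealP; split; first by exists 0%N => //; apply: (left_ideal0 lJ).
  move=> a x y [m _ Ix] [n _ Iy]; exists (maxn m n) => //.
  have [lI _ _] := tI (maxn m n); apply: (left_idealD lI).
    by apply: (left_idealM lI); apply: Ile Ix; apply: leq_maxl.
  by apply: Ile Iy; apply: leq_maxr.
have JU : J `<=` U by move=> j Jj; exists 0%N.
have [e [[n _ Ie] Je]] := complement_mod_jacobson ssB lU JU.
have IE : I n.+1 = I n.
  apply/seteqP; split; last exact: IS.
  have [lI JI _] := tI n; move=> x Ix; rewrite -[x](subrK (x * e)).
  apply: (left_idealD lI).
    by rewrite -[X in X - _]mulr1 -mulrBr; apply: (left_idealM lI).
  by apply: JI; apply: Je; exists n.+1.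
have I1 : I 1%N = J.
  elim: n {Ie} IE => [//|n IHn] e1; apply: IHn.
  apply: (socle_ann_inj (tI _) (tI _)).
  by apply: (socle_ann_inj (socle_ann_two_sided _) (socle_ann_two_sided _)).
rewrite -I1 => s t Ss _; rewrite mulrA cS ?mul0r //.
Qed.

(** For maximal [L] this says that the simple module [A / L] embeds in [A]: a
    complement [e] of [L] satisfies [L e <= J], so [L] annihilates [e S], which
    is nonzero because [S] is faithful on the left. *)
Lemma right_annihilator_neq0 (L : set A) : left_ideal L -> J `<=` L -> ~ L 1 ->
  exists h, h <> 0 /\ forall a, L a -> a * h = 0.
Proof.
move=> lL JL L1; have [e [Le Je]] := complement_mod_jacobson ssB lL JL.
have [s [Ss es0]] : exists s, S s /\ e * s <> 0.
  apply: contrapT => nex; apply: L1; rewrite -[1](subrK e).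
  apply: (left_idealD lL Le); apply: JL.
  apply: left_annihilator_left_socle => s Ss.
  by apply: contrapT => es0; apply: nex; exists s.
by exists (e * s); split=> // a /Je Jae; rewrite mulrA Ss.
Qed.

End Socle.

(** * Generators of the radical modulo its square *)

Section Generators.
Variable A : pzRingType.
Local Notation J := (@jacobson A).
Local Notation J2 := (@jpow A 2).
Hypothesis ssB : semisimple_ring (jacobson_quotient A).
Hypothesis nilJ : jacobson_nilpotent A.
Hypothesis injA : left_self_injective A.
Let lJ : left_ideal J := jacobson_left_ideal A.
Let lJ2 : left_ideal J2 := @jpow_left_ideal A 2.
Let lspan_left_ideal (X : set A) : left_ideal (lspan A X) :=
  @span_submod A A^o X.

Definition independent_mod_square (I : set A) : Prop :=
  forall x, I x -> ~ lspan A ((I `\ x) `|` J2) x.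

Definition simple_independent (I : set A) : Prop :=
  (forall x, I x -> J x /\ simple_mod J2 x) /\ independent_mod_square I.

(** A maximal independent set of elements of [J] that are simple modulo [J^2]
    generates: by simplicity, an element outside the span can be added to it
    without destroying independence, and [J] is spanned by such elements because
    [1] is a sum of elements that are simple modulo [J]. *)
Lemma exists_simple_generators :
  exists I, simple_independent I /\ J `<=` lspan A (I `|` J2).
Proof.
have [F FP Ftot|I [[IX Ind] Imax]] := @Zorn_bigcup _ simple_independent.
  split=> [x [X FX Xx]|x [X FX Xx]]; first exact: (FP X FX).1.
  pose Q := [set z | exists2 C, F C & lspan A ((C `\ x) `|` J2) z].
  suff FQ : lspan A ((\bigcup_(X in F) X) `\ x `|` J2) `<=` Q.
    move=> /FQ[C FC Cx]; have [XC|CX] := Ftot X C FX FC.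
      exact: ((FP C FC).2 x (XC x Xx)).
    apply: ((FP X FX).2 x Xx); move: Cx.
    apply: (@spanS A A^o); apply: setSU; exact: setSD.
  apply: (span_min (M := A^o)).
    apply/left_idealP; split.
      by exists X => //; apply: (left_ideal0 (lspan_left_ideal _)).
    move=> a y z [C FC Cy] [E FE Ez].
    have [CE|EC] := Ftot C E FC FE.
      exists E => //; apply: (left_idealD (lspan_left_ideal _)) => //.
      apply: (left_idealM (lspan_left_ideal _)).
      by move: Cy; apply: (@spanS A A^o); apply: setSU; apply: setSD.
    exists C => //; apply: (left_idealD (lspan_left_ideal _)).
      exact: (left_idealM (lspan_left_ideal _)).
    by move: Ez; apply: (@spanS A A^o); apply: setSU; apply: setSD.
  move=> y [[[C FC Cy] yx]|Jy]; last by exists X => //; apply: sub_span; right.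
  by exists C => //; apply: sub_span; left; split.
exists I; split=> // m Jm; have [n [u [su u1]]] := one_sum_simple ssB.
rewrite -[m]mul1r u1 mulr_suml.
apply: (@submod_sum A A^o _ (lspan_left_ideal _)) => i _.
set y := u i * m; have Jy : J y by apply: (left_idealM lJ).
have sy : simple_mod J2 y by apply: simple_mod_jpowS; rewrite ?jpow1.
apply: contrapT => nIy; apply: (Imax (I `|` [set y])).
  split; first by move=> ?; left.
  by move=> /(_ y (or_intror erefl)) Iy; apply: nIy; apply: sub_span; left.
split=> [x [/IX//|-> //]|x [Ix|->]]; last first.
  apply: contra_not nIy; apply: (@spanS A A^o); apply: setSU.
  by move=> z [[Iz|zy] nzy] //; case: nzy.
pose L := lspan A ((I `\ x) `|` J2).
have lL : left_ideal L by apply: lspan_left_ideal.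
move=> xin; have [a La] : adjoin L y x.
  move: xin; apply: (span_min (M := A^o)); first exact: adjoin_left_ideal.
  move=> z [[[Iz|->] zx]|J2z]; last 1 first.
  - by apply: sub_adjoin; apply: sub_span; right.
  - by apply: sub_adjoin; apply: sub_span; left.
  exact: mem_adjoin.
have J2L : J2 `<=` L by move=> z J2z; apply: sub_span; right.
have [/J2L Lay|/sy[b Jb]] := pselect (J2 (a * y)).
  apply: (Ind x Ix); rewrite -/L -[x](subrK (a * y)).
  exact: (left_idealD lL).
apply: nIy; set M := lspan A _.
have lM : left_ideal M by apply: lspan_left_ideal.
have LM : L `<=` M by apply: (@spanS A A^o); apply: setSU; apply: subDsetl.
have -> : y = b * x - b * (x - a * y) - (b * (a * y) - y).
  by rewrite mulrBr !subKr.
apply: (left_idealB lM); last by apply: sub_span; right.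
apply: (left_idealB lM); apply: (left_idealM lM); last exact: LM.
by apply: sub_span; left.
Qed.

Variable I : set A.
Hypothesis simpI : simple_independent I.

(** Collecting the terms of the sum that involve one generator [x], their
    total is in [J^2] by independence and is sent to zero by hypothesis; the
    other terms form a shorter sum. *)
Let combination_eq0 (g : A -> A) :
  (forall x a, I x -> J2 (a * x) -> a * g x = 0) ->
  forall s : seq (A * A), (forall p, p \in s -> I p.2) ->
  J2 (\sum_(p <- s) p.1 * p.2) -> \sum_(p <- s) p.1 * g p.2 = 0.
Proof.
move=> gP s; have [n] := ubnP (size s); elim: n s => // n IHn.
move=> [|p0 s] ltsn sI J2s; first by rewrite big_nil.
move: ltsn sI J2s; set x := p0.2; set s' := p0 :: s => ltsn sI J2s.
have Ix : I x by apply: sI; rewrite mem_head.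
pose c := \sum_(p <- s' | p.2 == x) p.1.
have coll (f : A -> A) : \sum_(p <- s') p.1 * f p.2 =
    c * f x + \sum_(p <- [seq p <- s' | p.2 != x]) p.1 * f p.2.
  rewrite /c; elim: {c ltsn sI J2s} s' => [|q r IHr] /=.
    by rewrite !big_nil mul0r addr0.
  rewrite !big_cons IHr; case: eqP => [->|_] /=; first by rewrite mulrDl addrA.
  by rewrite big_cons addrCA.
have fI p : p \in [seq p <- s' | p.2 != x] -> (I `\ x) p.2.
  by rewrite mem_filter => /andP[/eqP px /sI Ip]; split.
pose L := lspan A ((I `\ x) `|` J2).
have lL : left_ideal L by apply: lspan_left_ideal.
have J2c : J2 (c * x).
  apply: contrapT => /((simpI.1 x Ix).2 c)[b Jb].
  apply: (simpI.2 x Ix); rewrite -/L.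
  have -> : x = b * (c * x) - (b * (c * x) - x) by rewrite subKr.
  apply: (left_idealB lL); last by apply: sub_span; right.
  apply: (left_idealM lL).
  have -> : c * x = \sum_(p <- s') p.1 * p.2 -
      \sum_(p <- [seq p <- s' | p.2 != x]) p.1 * p.2.
    by rewrite (coll id) addrK.
  apply: (left_idealB lL); first by apply: sub_span; right.
  rewrite big_seq; apply: (@submod_sum A A^o _ lL) => p /fI Ip.
  by apply: (left_idealM lL); apply: sub_span; left.
rewrite coll gP // add0r; apply: IHn.
- rewrite /s' /= eqxx /=; move: ltsn; rewrite ltnS; apply: leq_ltn_trans.
  by rewrite size_filter; apply: count_size.
- by move=> p /fI[].
move: J2s; rewrite (coll id) => J2s.
rewrite -(addKr (c * x) (\sum_(_ <- _) _)) addrC.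
exact: (left_idealB lJ2).
Qed.

(** Independence makes the assignment [x |-> g x] extend to a left-linear map
    on [J] that vanishes on [J^2]; self-injectivity turns it into a right
    multiplication. *)
Lemma exists_right_factor (g : A -> A) :
  (forall x a, I x -> J2 (a * x) -> a * g x = 0) ->
  exists a, forall x, I x -> x * a = g x.
Proof.
move=> gP; pose N : set (A^o * A^o) := [set p | exists s : seq (A * A),
  [/\ forall q, q \in s -> I q.2, J2 (p.1 - \sum_(q <- s) q.1 * q.2) &
      p.2 = \sum_(q <- s) q.1 * g q.2]].
have sN : submodule N.
  apply/submoduleP; split.
    exists [::]; rewrite !big_nil subr0; split=> //.
    exact: (left_ideal0 lJ2).
  move=> b [u u'] [v v'] [s [sI /= Js ->]] [t [tI /= Jt ->]].
  exists ([seq (b * q.1, q.2) | q <- s] ++ t); split=> [q||].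
  - by rewrite mem_cat => /orP[/mapP[q' q's ->]|]; [apply: (sI q')|apply: tI].
  - rewrite big_cat big_map /= opprD addrACA; apply: (left_idealD lJ2) => //.
    under eq_bigr do rewrite -mulrA; rewrite -mulr_sumr -mulrBr.
    exact: (left_idealM lJ2).
  rewrite big_cat big_map /=; congr (_ + _).
  by rewrite /GRing.scale /= mulr_sumr; apply: eq_bigr => q _; rewrite mulrA.
have [|a aP] := functional_submodule_mulr injA sN.
  move=> y [s [sI /= Js ->]]; apply: combination_eq0 => //.
  by have := left_idealM lJ2 (-1) Js; rewrite sub0r mulN1r opprK.
exists a => x Ix; apply/esym/aP; exists [:: (1, x)].
rewrite !big_seq1 /= !mul1r subrr; split=> //; last exact: (left_ideal0 lJ2).
by move=> q; rewrite inE => /eqP->.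
Qed.

(** The annihilator of [x] modulo [J^2] is a proper left ideal, so some nonzero
    [h x] is annihilated by it, and so is [0]: a function taking one of these
    two values at each [x] always extends to a right multiplication. *)
Lemma exists_indicator_factors : exists h : A -> A,
  (forall x, I x -> h x <> 0) /\
  forall D : set A, exists a, forall x, I x ->
    (D x -> x * a = h x) /\ (~ D x -> x * a = 0).
Proof.
have /choice[h hP] x : exists h, I x ->
    h <> 0 /\ forall a, J2 (a * x) -> a * h = 0.
  have [Ix|nIx] := pselect (I x); last by exists 0.
  have [Jx _] := simpI.1 x Ix.
  have [|||h hP] := @right_annihilator_neq0 A ssB nilJ injA
    [set a | J2 (a * x)].
  - exact: left_ideal_colon.
  - by move=> j Jj; apply: jpowMJ; rewrite ?jpow1.
  - rewrite /= mul1r => J2x; apply: (simpI.2 x Ix).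
    by apply: sub_span; right.
  by exists h.
exists h; split=> [x /hP[]//|D].
have [a aP] : exists a, forall x, I x ->
    x * a = if `[< D x >] then h x else 0.
  apply: exists_right_factor => x a Ix Jax.
  by case: asboolP => _; [apply: (hP x Ix).2|rewrite mulr0].
exists a => x Ix; rewrite aP //.
by split=> Dx; [rewrite asboolT|rewrite asboolF].
Qed.

End Generators.

(** * Descending chains *)

Section Artinian.
Variable A : pzRingType.
Local Notation J := (@jacobson A).
Hypothesis ssB : semisimple_ring (jacobson_quotient A).
Hypothesis nilJ : jacobson_nilpotent A.
Let lJ : left_ideal J := jacobson_left_ideal A.
Let lspan_left_ideal (X : set A) : left_ideal (lspan A X) :=
  @span_submod A A^o X.

(** The descending chain condition in [A / P], where the conclusion compares
    [I m + P] with [I n + P]. *)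
Definition artinian_mod (P : set A) : Prop :=
  forall I : nat -> set A, (forall n, left_ideal (I n)) ->
    (forall n, I n.+1 `<=` I n) ->
    exists m, forall n, (m <= n)%N ->
      forall y, I m y -> exists2 z, I n z & P (y - z).

Lemma chain_le (I : nat -> set A) : (forall n, I n.+1 `<=` I n) ->
  forall m n, (m <= n)%N -> I n `<=` I m.
Proof.
move=> Idec m n /subnK <-; elim: (n - m)%N => [//|k IHk].
by apply: subset_trans IHk; apply: Idec.
Qed.

(** Either every term of the chain meets the coset [x + P], and then the chain
    absorbs [A x] modulo [P], or some term avoids it, and then by simplicity
    its intersection with [P + A x] is contained in [P]. *)
Lemma artinian_mod_simple (P Q : set A) (x : A) :
  left_ideal P -> simple_mod P x -> Q `<=` adjoin P x ->
  artinian_mod Q -> artinian_mod P.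
Proof.
move=> lP sx QP artQ I lI Idec; have [m mP] := artQ I lI Idec.
have Ile := chain_le Idec.
have [xI|/existsNP[n1 nx]] := pselect (forall n, exists2 z, I n z & P (x - z)).
  exists m => n mn y Iy; have [z Iz /QP[a Pa]] := mP n mn y Iy.
  have [z' Iz' Pz'] := xI n; exists (z + a * z').
    by apply: (left_idealD (lI n)) => //; apply: (left_idealM (lI n)).
  have -> : y - (z + a * z') = a * (x - z') + (y - z - a * x).
    by rewrite mulrBr opprD addrA [RHS]addrC addrA subrK.
  by apply: (left_idealD lP) => //; apply: (left_idealM lP).
exists (maxn m n1) => n; rewrite geq_max => /andP[mn n1n] y Iy.
have [z Iz /QP[a Pa]] := mP n mn y (Ile _ _ (leq_maxl m n1) _ Iy).
exists z => //; have [Pax|/sx[b Pb]] := pselect (P (a * x)).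
  by rewrite -[y - z](subrK (a * x)); apply: (left_idealD lP).
case: nx; exists (b * (y - z)).
  apply: (left_idealM (lI n1)); apply: (left_idealB (lI n1)).
    exact: (Ile _ _ (leq_maxr m n1)).
  exact: (Ile _ _ n1n).
have -> : x - b * (y - z) = - 1 * (b * (a * x) - x) - b * (y - z - a * x).
  by rewrite mulN1r opprB [b * (_ - a * x)]mulrBr opprB addrA subrK.
by apply: (left_idealB lP); apply: (left_idealM lP).
Qed.

Lemma simple_modS (P P' : set A) x :
  P `<=` P' -> simple_mod P x -> simple_mod P' x.
Proof.
move=> PP' sx a nP'; have [|b Pb] := sx a; first by move=> /PP'.
by exists b; apply: PP'.
Qed.

Lemma artinian_mod_span (gs : seq A) (P Q : set A) : left_ideal P ->
  (forall g, g \in gs -> simple_mod P g) ->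
  Q `<=` lspan A (P `|` [set` gs]) -> artinian_mod Q -> artinian_mod P.
Proof.
elim: gs P => [|g gs IHg] P lP sgs Qgs artQ.
  have QP : Q `<=` P.
    by apply: subset_trans Qgs _; apply: (span_min (M := A^o)) => // x [].
  move=> I lI Idec; have [m mP] := artQ I lI Idec.
  by exists m => n mn y /(mP n mn)[z Iz /QP Pz]; exists z.
pose P' := adjoin P g.
have lP' : left_ideal P' by apply: adjoin_left_ideal.
have PP' : P `<=` P' by apply: sub_adjoin.
apply: (@artinian_mod_simple P P' g) => //.
  by apply: sgs; rewrite mem_head.
apply: (IHg P' lP') => [h hgs||//].
  by apply: (simple_modS PP'); apply: sgs; rewrite inE hgs orbT.
apply: subset_trans Qgs _; apply: (span_min (M := A^o)).
  exact: lspan_left_ideal.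
move=> z [/PP' P'z|/=]; first by apply: sub_span; left.
rewrite inE => /predU1P[->|zgs]; last by apply: sub_span; right.
by apply: sub_span; left; apply: mem_adjoin.
Qed.

Variable xs : seq A.
Hypothesis xsJ : forall x, x \in xs -> J x.
Hypothesis Jxs : J `<=` lspan A ([set` xs] `|` @jpow A 2).

Let words m := iter m (fun ws => [seq x * w | x <- xs, w <- ws]) [:: 1].

Let words_jpow m w : w \in words m -> @jpow A m w.
Proof.
elim: m w => [//|m IHm] w /allpairsP[[x v] [/= xxs /IHm Jv ->]].
by apply: jpowMJ => //; apply: xsJ.
Qed.

(** The generators of [J] modulo [J^2] have products of length [m] that generate
    [J^m] modulo the next power. *)
Let jpow_words m : @jpow A m `<=` lspan A (@jpow A m.+1 `|` [set` words m]).
Proof.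
elim: m => [|m IHm].
  move=> x _; rewrite -[x]mulr1; apply: (left_idealM (lspan_left_ideal _)).
  by apply: sub_span; right; rewrite /= inE.
set L := lspan A (_ `|` [set` words m.+1]).
have lL : left_ideal L by apply: lspan_left_ideal.
apply: (span_min (M := A^o)) => // _ [x [y [Jx Jy ->]]].
pose Q := [set y | forall x, J x -> L (x * y)].
suff QT : lspan A (@jpow A m.+1 `|` [set` words m]) `<=` Q.
  by apply: (QT y (IHm y Jy)).
apply: (span_min (M := A^o)).
  apply/left_idealP; split=> [z _|a u v Qu Qv z Jz].
    by rewrite mulr0; apply: (left_ideal0 lL).
  rewrite mulrDr mulrA; apply: (left_idealD lL); last exact: Qv.
  by apply: Qu; apply: jacobson_right.
move=> w [Jw|/= wm] z Jz; first by apply: sub_span; left; apply: jpowMJ.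
suff JL : J `<=` [set z | L (z * w)] by apply: JL.
apply: subset_trans Jxs _; apply: (span_min (M := A^o)).
  exact: left_ideal_colon.
move=> u [/= uxs|J2u]; apply: sub_span; [right|left].
  by apply/allpairsP; exists (u, w).
exact: (jpowM J2u (words_jpow wm)).
Qed.

(** Multiplying the words by the summands of [1] that are simple modulo [J]
    gives finitely many elements that generate [J^m] modulo [J^(m+1)] and are
    simple modulo the latter. *)
Lemma left_artinian_of_generators : left_artinian A.
Proof.
have [n [u [su u1]]] := one_sum_simple ssB.
suff art m : artinian_mod (@jpow A m).
  have [m Jm] := jpow_eq0 nilJ; have := art m; rewrite Jm => art0 I lI Idec.
  have [k kP] := art0 I lI Idec; exists k => l kl.
  apply/seteqP; split; first exact: chain_le kl.
  by move=> y /(kP l kl)[z Iz /eqP]; rewrite subr_eq0 => /eqP->.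
elim: m => [|m IHm].
  move=> I lI _; exists 0%N => l _ y _; exists 0 => //.
  exact: (left_ideal0 (lI l)).
pose gs := [seq u i * w | i <- enum 'I_n, w <- words m].
apply: (@artinian_mod_span gs _ _ _ _ _ IHm).
- exact: jpow_left_ideal.
- move=> _ /allpairsP[[i w] [/= _ wm ->]].
  by apply: simple_mod_jpowS; [apply: su|apply: words_jpow].
apply: subset_trans (@jpow_words m) _; apply: (span_min (M := A^o)).
  exact: lspan_left_ideal.
move=> w [Jw|/= wm]; first by apply: sub_span; left.
rewrite -[w]mul1r u1 mulr_suml.
apply: (@submod_sum A A^o _ (lspan_left_ideal _)) => i _.
apply: sub_span; right; apply/allpairsP; exists (i, w).
by rewrite mem_enum.
Qed.

End Artinian.

(** * Words and the size of the ring *)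

Section Counting.
Variables (K : fieldType) (A : pzRingType) (iota : {rmorphism K -> A}).
Hypothesis iota_central : forall (k : K) (a : A), iota k * a = a * iota k.
Local Notation J := (@jacobson A).
Local Notation J2 := (@jpow A 2).
Local Notation AK := (restrict_scalars iota A^o).
Let lJ : left_ideal J := jacobson_left_ideal A.
Let lJ2 : left_ideal J2 := @jpow_left_ideal A 2.

Definition kspan (X : set A) : set A := @span K AK X.

Lemma kspan_submod X : @submodule K AK (kspan X).
Proof. exact: span_submod. Qed.

Lemma kspan_min (X N : set A) : @submodule K AK N -> X `<=` N -> kspan X `<=` N.
Proof. exact: (@span_min K AK). Qed.

Lemma ksubmoduleP (N : set A) : @submodule K AK N <->
  N 0 /\ (forall k x y, N x -> N y -> N (iota k * x + y)).
Proof. exact: (@submoduleP K AK). Qed.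

Section Words.
Variable (L : Type) (letter : L -> A).

Definition word_eval (w : seq L) : A := \prod_(l <- w) letter l.
Definition word_span : set A := kspan (range word_eval).

Lemma word_spanM x y : word_span x -> word_span y -> word_span (x * y).
Proof.
move=> Wx Wy; pose N := [set x | word_span (x * y)].
suff : word_span `<=` N by apply.
have [W0 WD] := (ksubmoduleP _).1 (@kspan_submod (range word_eval)).
apply: kspan_min.
  apply/ksubmoduleP; rewrite /N; split=> [|k u v Nu Nv] /=.
    by rewrite mul0r.
  by rewrite mulrDl -mulrA; apply: WD.
move=> _ [w _ <-]; rewrite /N /=.
pose N' := [set y | word_span (word_eval w * y)].
suff : word_span `<=` N' by apply.
apply: kspan_min.
  apply/ksubmoduleP; rewrite /N'; split=> [|k u v Nu Nv] /=.
    by rewrite mulr0.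
  by rewrite mulrDr mulrA -iota_central -mulrA; apply: WD.
move=> _ [w' _ <-]; rewrite /N' /=; apply: (@sub_span K AK).
by exists (w ++ w') => //; rewrite /word_eval big_cat.
Qed.

Lemma word_span_letter l : word_span (letter l).
Proof.
apply: (@sub_span K AK); exists [:: l] => //.
by rewrite /word_eval big_seq1.
Qed.

Hypothesis nilJ : jacobson_nilpotent A.
Hypothesis top_words : forall a, exists2 m, word_span m & J (a - m).
Hypothesis J_words : J `<=` lspan A ((range letter `&` J) `|` J2).

Let sW : @submodule K AK word_span := @kspan_submod _.
Let WD x y (Wx : word_span x) (Wy : word_span y) : word_span (x + y) :=
  @submodD K AK _ sW x y Wx Wy.
Let W0 : word_span 0 := @submod0 K AK _ sW.

Let add_jpow n x y : (exists2 m, word_span m & @jpow A n (x - m)) ->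
  (exists2 m, word_span m & @jpow A n (y - m)) ->
  exists2 m, word_span m & @jpow A n (x + y - m).
Proof.
move=> [m Wm Jm] [m' Wm' Jm']; exists (m + m'); first exact: WD.
by rewrite opprD addrACA; apply: (left_idealD (@jpow_left_ideal A n)).
Qed.

Let J_mod_J2 x : J x -> exists2 m, word_span m & J2 (x - m).
Proof.
move=> Jx; rewrite -[x]mul1r.
pose Q := [set x | forall a, exists2 m, word_span m & J2 (a * x - m)].
suff /(_ x Jx) : J `<=` Q by apply.
apply: subset_trans J_words _; apply: (span_min (M := A^o)).
  apply/left_idealP; split=> [a|b y z Qy Qz a].
    by exists 0 => //; rewrite mulr0 subr0; apply: (left_ideal0 lJ2).
  by rewrite mulrDr mulrA; apply: add_jpow.
move=> y [[[l _ <-] Jl]|J2y] a; last first.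
  by exists 0 => //; rewrite subr0; apply: (left_idealM lJ2).
have [m Wm Jam] := top_words a; exists (m * letter l).
  by apply: word_spanM => //; apply: word_span_letter.
by rewrite -mulrBl; apply: jpowMJ; rewrite ?jpow1.
Qed.

(** Modulo the next power of [J], a product of elements of [J] only depends on
    its factors modulo [J^2], which can be replaced by words. *)
Let jpow_mod_jpowS n x :
  @jpow A n x -> exists2 m, word_span m & @jpow A n.+1 (x - m).
Proof.
elim: n x => [|n IHn] x; first by move=> _; rewrite jpow1; apply: top_words.
have lJn : left_ideal (@jpow A n.+2) := @jpow_left_ideal A n.+2.
move=> Jx; rewrite -[x]mul1r.
pose Q := [set x | forall a, exists2 m, word_span m & @jpow A n.+2 (a * x - m)].
suff QT : @jpow A n.+1 `<=` Q by apply: (QT x Jx).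
apply: (span_min (M := A^o)).
  apply/left_idealP; split=> [a|b y z Qy Qz a].
    by exists 0 => //; rewrite mulr0 subr0; apply: (left_ideal0 lJn).
  by rewrite mulrDr mulrA; apply: add_jpow.
move=> _ [u [v [Ju Jv ->]]] a.
have Jau : J (a * u) by apply: (left_idealM lJ).
have [m Wm Jm] := J_mod_J2 Jau; have [m' Wm' Jm'] := IHn v Jv.
exists (m * m'); first exact: word_spanM.
have -> : a * (u * v) - m * m' = (a * u - m) * v + m * (v - m').
  by rewrite mulrBl mulrBr mulrA addrA subrK.
apply: (left_idealD lJn); first exact: (jpowM Jm Jv).
apply: jpowMJ => //; rewrite -[m](subKr (a * u)); apply: (left_idealB lJ) => //.
by rewrite -jpow1; apply: jpowS.
Qed.

Lemma word_span_all x : word_span x.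
Proof.
have [n Jn] := jpow_eq0 nilJ.
have WJ m : exists2 y, word_span y & @jpow A m (x - y).
  elim: m => [|m [y Wy /jpow_mod_jpowS[z Wz Jz]]]; first by exists 0.
  by exists (y + z); [apply: WD|rewrite opprD addrA].
by have [y Wy] := WJ n; rewrite Jn => /eqP; rewrite subr_eq0 => /eqP->.
Qed.

Lemma word_combination x : exists (F : seq (seq L)) (c : nat -> K),
  x = \sum_(j < size F) iota (c j) * word_eval (nth [::] F j).
Proof.
have [n [c [e [eW ->]]]] := span_sums (word_span_all x).
have /choice[w wP] i : exists w, word_eval w = e i.
  by have [w _ <-] := eW i; exists w.
exists [seq w i | i <- enum 'I_n], (fun j => oapp c 0 (insub j)).
rewrite size_map size_enum_ord; apply: eq_bigr => i _.
by rewrite valK /= (nth_map i) ?size_enum_ord // nth_ord_enum wP.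
Qed.

End Words.

(** Fewer than [m + 1] elements of [A] cannot produce the [m + 1] linearly
    independent vectors that have one nonzero coordinate each: their
    coefficient matrix has more rows than columns, and a linear relation between
    its rows is one between the vectors. *)
Lemma exists_missed_coordinate m (v : 'I_m -> A) (x h : 'I_m.+1 -> A) :
  (forall k, h k <> 0) ->
  exists i, forall c : 'I_m -> K,
    ~ (forall k, x k * (\sum_j iota (c j) * v j) = if k == i then h k else 0).
Proof.
move=> h0; apply: contrapT => nex.
have /choice[c cP] i : exists c : 'I_m -> K,
    forall k, x k * (\sum_j iota (c j) * v j) = if k == i then h k else 0.
  by apply: contrapT => nc; apply: nex; exists i => c cP; apply: nc; exists c.
pose M := \matrix_(i, j) c i j.
have : kermx M != 0.
  rewrite kermx_eq0 /row_free neq_ltn; apply/orP; left.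
  by rewrite ltnS; apply: rank_leq_col.
case/rowV0Pn => d /sub_kermxP dM0 d0; case/negP: d0; apply/eqP/rowP => k.
rewrite mxE; apply/eqP; apply: contrapT => /negP dk0.
have : iota (d 0 k) * h k = 0.
  have <- : \sum_i iota (d 0 i) * (x k * (\sum_j iota (c i j) * v j)) =
      iota (d 0 k) * h k.
    rewrite (bigD1 k) //= cP eqxx big1 ?addr0 // => i ik.
    by rewrite cP eq_sym (negPf ik) mulr0.
  under eq_bigr => i _ do rewrite mulrA iota_central -mulrA mulr_sumr.
  rewrite -mulr_sumr exchange_big /= big1 ?mulr0 // => j _.
  under eq_bigr => i _ do rewrite mulrA -rmorphM.
  rewrite -mulr_suml -rmorph_sum.
  suff -> : \sum_i d 0 i * c i j = 0 by rewrite rmorph0 mul0r.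
  have /rowP/(_ j) := dM0; rewrite !mxE => dj; rewrite -[RHS]dj.
  by apply: eq_bigr => i _; rewrite mxE.
move=> /(congr1 ( *%R (iota (d 0 k)^-1))).
rewrite mulr0 mulrA -rmorphM mulVf //.
by rewrite rmorph1 mul1r; apply: h0.
Qed.


Hypothesis ssB : semisimple_ring (jacobson_quotient A).
Hypothesis nilJ : jacobson_nilpotent A.
Hypothesis injA : left_self_injective A.
Variable C : nat -> A.
Hypothesis top_countable : forall a, exists2 m, kspan (range C) m & J (a - m).

(** The diagonal argument. Every element of [A] is a combination of a finite
    list [F] of words in the countable set [C] and in [I]. The infinite set
    [I] contains pairwise disjoint blocks, one for each [F], with one more
    element than [F]; in each block choose the element that the combinations of
    [F] cannot single out. No right multiplication cuts out the set of all the
    chosen elements. *)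
Lemma simple_generators_finite (I : set A) :
  simple_independent I -> J `<=` lspan A (I `|` J2) -> finite_set I.
Proof.
move=> simpI JI; apply: contrapT => infI.
have [h [h0 hD]] := exists_indicator_factors ssB nilJ injA simpI.
pose T := set_type I.
have [f finj] : exists f : seq T -> T, injective f.
  apply: inj_seq_infinite => /(finite_image val); apply: contra_not infI.
  apply: sub_finite_set => x Ix; exists (SigSub (mem_set Ix)) => //.
have It (t : T) : I (val t) by apply: set_valP.
pose L := (nat + T)%type.
pose value (l : L) := match l with inl n => C n | inr t => val t end.
pose W := seq L.
have all_words : forall x, exists (F : seq W) (c : nat -> K),
    x = \sum_(j < size F) iota (c j) * word_eval value (nth [::] F j).
  apply: (@word_combination L value) => // [a|].
    have [m Cm Jm] := top_countable a; exists m => //.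
    move: Cm; apply: kspan_min; first exact: kspan_submod.
    by move=> _ [n _ <-]; apply: (@word_span_letter L value (inl n)).
  apply: subset_trans JI _; apply: (@spanS A A^o) => x [Ix|]; last by right.
  left; split; last by have [] := simpI.1 x Ix.
  by exists (inr (SigSub (mem_set Ix))).
pose t0 := f [::].
(* At least two copies of [t0] in the first case, to keep the cases apart. *)
pose letter (l : L) :=
  match l with inl n => f (nseq n.+2 t0) | inr t => f [:: t] end.
have letter_inj : injective letter.
  move=> [m|s] [n|t] /= /finj // => [/(congr1 size)|[->] //].
  by rewrite /= !size_nseq => -[->].
pose code (p : seq W * nat) : T :=
  f [:: f (map (fun w => f (map letter w)) p.1); f (nseq p.2 t0)].
have code_inj : injective code.
  move=> [F n] [G m] /finj[/finj e1 /finj/(congr1 size)].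
  rewrite !size_nseq => ->.
  congr (_, _); move: e1; apply: inj_map => u v /finj; exact: inj_map.
pose block F (k : nat) := val (code (F, k)).
have /choice[i0 i0P] (F : seq W) : exists i : nat,
    forall c : 'I_(size F) -> K, ~ (forall k : 'I_(size F).+1, block F k *
      (\sum_j iota (c j) * word_eval value (nth [::] F j)) =
      if k == i :> nat then h (block F k) else 0).
  have [k|i iP] := @exists_missed_coordinate (size F)
    (fun j => word_eval value (nth [::] F j)) (block F)
    (fun k => h (block F k)).
    by apply: h0; apply: It.
  by exists i.
have [a aP] := hD [set x | exists F, x = block F (i0 F)].
have [F [c aE]] := all_words a.
apply: (i0P F (fun j => c j)) => k; rewrite -aE.
have [aD anD] := aP (block F k) (It _).
case: eqP => [ki0|ki0]; first by apply: aD; exists F; rewrite ki0.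
apply: anD => -[G /val_inj/code_inj[FG kG]]; apply: ki0.
by rewrite kG FG.
Qed.

End Counting.

(** * Countable dimension *)

Section CountableDimension.
Variables (K : fieldType) (V : lmodType K).

(** The elements of the sequence that do not depend on the earlier ones form a
    basis. *)
Lemma countable_dim_of_span (f : nat -> V) :
  (forall v, span (range f) v) -> countable_dim V.
Proof.
move=> fV; pose before n := span (f @` [set k | (k < n)%N]).
pose B := [set v | exists2 n, v = f n & ~ before n (f n)].
exists B; split.
- move=> n e c einj eB ec0.
  have /choice[idx idxP] i : exists m, e i = f m /\ ~ before m (f m).
    by have [m em nm] := eB i; exists m.
  move=> i0; apply/eqP; apply: contrapT => /negP ci0.
  (* In a relation, the element that comes last in the sequence would depend
     on the earlier ones. *)
  case: (@arg_maxnP _ i0 (fun i => c i != 0) idx ci0) => i ci imax.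
  have [ei nbi] := idxP i; apply: nbi; rewrite -ei.
  have -> : e i = \sum_(j | j != i) (- ((c i)^-1 * c j)) *: e j.
    have := ec0; rewrite (bigD1 i) //= => /eqP; rewrite addr_eq0 => /eqP.
    move=> /(congr1 ( *:%R (c i)^-1)); rewrite scalerA mulVf // scale1r => ->.
    rewrite scalerN scaler_sumr -sumrN; apply: eq_bigr => j _.
    by rewrite scalerA scaleNr.
  have sb : submodule (before (idx i)) by apply: span_submod.
  apply: (submod_sum sb) => j ji; have [->|cj] := eqVneq (c j) 0.
    by rewrite mulr0 oppr0 scale0r; apply: (submod0 sb).
  apply: (submodZ sb); apply: sub_span; have [-> _] := idxP j.
  exists (idx j) => //=.
  rewrite ltn_neqAle; apply/andP; split; last exact: imax.
  apply: contra ji => /eqP ij; apply/eqP; apply: einj.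
  by have [-> _] := idxP j; rewrite ei ij.
- move=> v; suff : span B v.
    by move=> /span_sums[n [c [e [eB vE]]]]; exists n, e, c.
  apply: (span_min (span_submod B)) (fV v) => _ [n _ <-].
  have [m] := ubnP n; elim: m n => // m IHm n; rewrite ltnS => nm.
  have [bn|nbn] := pselect (before n (f n)); last by apply: sub_span; exists n.
  apply: (span_min (span_submod B)) bn => _ [k /= kn <-].
  by apply: IHm; apply: leq_trans nm.
apply: (@sub_countable _ _ _ (range f)); last first.
  exact: (sub_countable (card_image_le f setT) (countableP setT)).
by apply: subset_card_le => _ [n -> _]; exists n.
Qed.

Lemma countable_dim_span :
  countable_dim V -> exists f : nat -> V, forall v, span (range f) v.
Proof.
move=> [B [_ Bspan /countable_injP[g ginj]]].
have /choice[f fP] n : exists v, forall x, B x -> g x = n -> x = v.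
  have [[v Bv gv]|nv] := pselect (exists2 v, B v & g v = n); last first.
    by exists 0 => x Bx gx; case: nv; exists x.
  by exists v => x Bx gx; apply: ginj; rewrite ?inE // gx gv.
exists f => v; have [n [e [c [eB ->]]]] := Bspan v.
apply: (submod_sum (span_submod _)) => i _; apply: (submodZ (span_submod _)).
by apply: sub_span; exists (g (e i)) => //; rewrite -(fP _ (e i)).
Qed.

End CountableDimension.

Section CountableTop.
Variables (K : fieldType) (A : pzRingType) (iota : {rmorphism K -> A}).
Local Notation J := (@jacobson A).
Local Notation top := (jacobson_quotient A).
Local Notation topK := (restrict_scalars (@jacobson_proj A \o iota) top^o).
Let lJ : left_ideal J := jacobson_left_ideal A.

Lemma simple_module_cyclic (M : lmodType A) (x : M) :
  simple_module M -> x <> 0 -> forall v, exists a, v = a *: x.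
Proof.
move=> [_ simM] x0 v; have [||T] := simM [set v | exists a, v = a *: x].
- apply/submoduleP; split; first by exists 0; rewrite scale0r.
  by move=> a _ _ [b ->] [c ->]; exists (a * b + c); rewrite scalerDl scalerA.
- move=> T0; have : [set v | exists a, v = a *: x] x.
    by exists 1; rewrite scale1r.
  by rewrite T0.
by have : setT v by []; rewrite -T.
Qed.

(** The annihilator of a nonzero element of a simple module is a maximal left
    ideal. *)
Lemma simple_module_jacobson (M : lmodType A) (x : M) j :
  simple_module M -> J j -> j *: x = 0.
Proof.
move=> simM Jj; have [->|/eqP x0] := eqVneq x 0; first by rewrite scaler0.
apply: (Jj [set a | a *: x = 0]); split.
- apply/left_idealP; split=> [|a b c /= bx cx] /=; first by rewrite scale0r.
  by rewrite scalerDl -scalerA bx cx scaler0 addr0.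
- move=> T; have : setT (1 : A) by [].
  by rewrite -T /= scale1r.
move=> I lI annI; have [|I0|IT] := simM.2 [set v | exists2 a, I a & v = a *: x].
- apply/submoduleP; split.
    by exists 0; [apply: (left_ideal0 lI)|rewrite scale0r].
  move=> a _ _ [b Ib ->] [c Ic ->].
  exists (a * b + c); last by rewrite scalerDl scalerA.
  by apply: (left_idealD lI) => //; apply: (left_idealM lI).
- left; apply/seteqP; split=> // a Ia /=.
  have : [set v | exists2 a, I a & v = a *: x] (a *: x) by exists a.
  by rewrite I0.
right; apply/seteqP; split=> // a _.
have [b Ib xE] : [set v | exists2 a, I a & v = a *: x] x by rewrite IT.
rewrite -[a]mulr1; apply: (left_idealM lI); rewrite -[1](subrK b).
apply: (left_idealD lI) => //; apply: annI.
by rewrite /= scalerBl scale1r -xE subrr.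
Qed.

Lemma top_lifts (f : nat -> topK) :
  exists C : nat -> A, forall n, f n = jacobson_proj (C n).
Proof. by have /choice[C CP] n := jacobson_proj_surj (f n); exists C. Qed.

Lemma top_scale (k : K) (a b : A) :
  k *: (jacobson_proj a : topK) + jacobson_proj b =
  jacobson_proj (iota k * a + b).
Proof. by rewrite raddfD /= rmorphM. Qed.

(** A simple module is a quotient of [A / J], as it is cyclic and killed by
    [J]. *)
Lemma countable_top_simple : countable_dim topK ->
  forall M : lmodType A, simple_module M ->
  countable_dim (restrict_scalars iota M).
Proof.
move=> /countable_dim_span[f ftop] M simM.
have [C CE] := top_lifts f; have [x x0] := simM.1.
pose MK := restrict_scalars iota M.
apply: (@countable_dim_of_span K MK (fun n => C n *: x)) => v.
have [a ->] := simple_module_cyclic simM x0 v.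
set W := span _; have /submoduleP[W0 WD] : submodule W by apply: span_submod.
have projx b c : jacobson_proj b = jacobson_proj c -> b *: x = c *: x.
  move=> /jacobson_projP Jbc; apply/eqP; rewrite -subr_eq0 -scalerBl; apply/eqP.
  exact: simple_module_jacobson.
pose N : set topK := [set q | forall a, q = jacobson_proj a -> W (a *: x)].
suff NT : span (range f) `<=` N by apply: (NT (jacobson_proj a) (ftop _)).
apply: span_min.
  apply/submoduleP; split=> [b b0|k q r Nq Nr b bE].
    by rewrite (projx b 0) ?scale0r // -b0 raddf0.
  have [c qE] := jacobson_proj_surj q; have [d rE] := jacobson_proj_surj r.
  have := WD k _ _ (Nq c qE) (Nr d rE).
  rewrite (projx b (iota k * c + d)) ?scalerDl -?scalerA //.
  by rewrite -bE -top_scale qE rE.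
move=> _ [n _ <-] b; rewrite CE => /projx <-.
by apply: sub_span; exists n.
Qed.

Lemma countable_top_lift : countable_dim topK ->
  exists C : nat -> A, forall a, exists2 m, kspan iota (range C) m & J (a - m).
Proof.
move=> /countable_dim_span[f ftop]; have [C CE] := top_lifts f.
exists C => a; pose W := kspan iota (range C).
have [W0 WD] := (ksubmoduleP iota W).1 (@kspan_submod _ _ iota (range C)).
pose N : set topK := [set q | exists2 m, W m & jacobson_proj m = q].
suff NT : span (range f) `<=` N.
  have [m Wm mE] := NT (jacobson_proj a) (ftop _).
  by exists m => //; apply/jacobson_projP.
apply: span_min.
  apply/submoduleP; split; first by exists 0; rewrite ?raddf0.
  move=> k _ _ [m Wm <-] [m' Wm' <-]; exists (iota k * m + m'); first exact: WD.
  by rewrite top_scale.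
move=> _ [n _ <-]; exists (C n) => //.
by apply: (@sub_span K (restrict_scalars iota A^o)); exists n.
Qed.

Hypothesis ssB : semisimple_ring top.

(** [A / J] is a finite sum of submodules [A (u i)], each simple or zero. *)
Lemma simple_countable_top :
  (forall M : lmodType A, simple_module M ->
     countable_dim (restrict_scalars iota M)) ->
  countable_dim topK.
Proof.
move=> simC; have [n [u [su u1]]] := one_sum_simple ssB.
suff /choice[f fP] (i : 'I_n) : exists f : nat -> topK,
    forall a, span (range f) (jacobson_proj (a * u i)).
  pose g m := if unpickle m is Some (i, k) then f i k else 0.
  apply: (@countable_dim_of_span _ _ g) => q.
  have [a ->] := jacobson_proj_surj q.
  rewrite -[a]mulr1 u1 mulr_sumr raddf_sum.
  apply: (submod_sum (span_submod _)) => i _.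
  apply: spanS (fP i a) => _ [k _ <-]; exists (pickle (i, k)) => //.
  by rewrite /g pickleK.
have [Jui|nJui] := pselect (J (u i)).
  exists (fun=> 0) => a.
  suff -> : jacobson_proj (a * u i) = 0 by apply: (submod0 (span_submod _)).
  rewrite -(raddf0 (@jacobson_proj A)); apply/jacobson_projP; rewrite subr0.
  exact: (left_idealM lJ).
pose topA := restrict_scalars (@jacobson_proj A) top^o.
pose N : set topA := [set q | exists a, q = jacobson_proj (a * u i)].
have sN : submodule N.
  apply/submoduleP; split; first by exists 0; rewrite mul0r raddf0.
  move=> a _ _ [b ->] [c ->]; exists (a * b + c).
  by rewrite mulrDl jacobson_projD -mulrA (jacobson_projM a).
pose el a : submod_type sN :=
  exist _ (jacobson_proj (a * u i)) (mem_set (ex_intro _ a erefl)).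
have simN : simple_module (submod_type sN).
  split.
    exists (el 1) => /(congr1 val) /=; rewrite mul1r.
    by rewrite -(raddf0 (@jacobson_proj A)) => /jacobson_projP; rewrite subr0.
  move=> P sP.
  have [[p [Pp p0]]|P0] := pselect (exists p, P p /\ p <> 0); last first.
    left; apply/seteqP; split=> [p Pp|_ ->]; last exact: submod0 sP.
    by apply: contrapT => p0; apply: P0; exists p.
  right; apply/seteqP; split=> // q _.
  have elP (r : submod_type sN) : exists a, r = el a.
    have [r' [a rE]] : exists r' a, val r = r' /\ r' = jacobson_proj (a * u i).
      by have /set_mem[a ra] := valP r; exists (val r), a.
    by exists a; apply: val_inj; case: rE => -> ->.
  have [[a pE] [b qE]] := (elP p, elP q).
  have [|c Jc] := su i a.
    move=> Jau; apply: p0; rewrite pE; apply: val_inj => /=.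
    rewrite -(raddf0 (@jacobson_proj A)); apply/jacobson_projP.
    by rewrite subr0.
  suff -> : q = (b * c) *: p by apply: (submodZ sP).
  rewrite qE pE; apply: val_inj => /=.
  transitivity (jacobson_proj (b * c * (a * u i))); last by rewrite rmorphM.
  apply/jacobson_projP.
  have -> : b * u i - b * c * (a * u i) = - b * (c * (a * u i) - u i).
    by rewrite mulNr mulrBr opprB !mulrA.
  exact: (left_idealM lJ).
have /countable_dim_span[f fN] := simC _ simN.
pose g k : topK := val (f k : submod_type sN); exists g => a.
have /submoduleP[W0 WD] := span_submod (range g).
pose Q : set (restrict_scalars iota (submod_type sN)) :=
  [set r | span (range g) (val (r : submod_type sN))].
suff QT : span (range f) `<=` Q by apply: (QT (el a) (fN _)).
apply: span_min.
  apply/submoduleP; split=> [|k q r Qq Qr]; first exact: W0.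
  have := @submod_val_linear _ _ _ sN (iota k) q r.
  rewrite /Q /= => ->; exact: WD.
by move=> _ [k _ <-]; apply: (@sub_span K topK (range g) (g k)); exists k.
Qed.

End CountableTop.

(** * The quasi-Frobenius property *)

Theorem theorem2p3 (K : fieldType) (A : pzRingType) (iota : {rmorphism K -> A})
    (iota_central : forall (k : K) (a : A), iota k * a = a * iota k)
    (A_semiprimary : semiprimary A)
    (A_self_injective : left_self_injective A) :
  ((forall S : lmodType A, simple_module S ->
      countable_dim (restrict_scalars iota S)) <->
   countable_dim (restrict_scalars (@jacobson_proj A \o iota)
                    (jacobson_quotient A)^o)) /\
  ((forall S : lmodType A, simple_module S ->
      countable_dim (restrict_scalars iota S)) ->
   quasi_frobenius A).
Proof.
have [ssB nilJ] := A_semiprimary.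
have topC := @simple_countable_top K A iota ssB.
split=> [|/topC topK]; first by split=> //; apply: countable_top_simple.
split=> //; have [C CP] := countable_top_lift topK.
have [I [simpI JI]] := exists_simple_generators ssB.
have /finite_seqP[xs xsI] : finite_set I.
  exact: (simple_generators_finite iota_central ssB nilJ A_self_injective CP
    simpI JI).
apply: (@left_artinian_of_generators A ssB nilJ xs); last by rewrite -xsI.
by move=> x xxs; have [|] := simpI.1 x; first by rewrite xsI.
Qed.
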